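(* Suppose that for $\ell=1,2$ the spectral measure $F_\ell$ is absolutely continuous with respect to Lebesgue measure on $\mathbb{R}^d$ with spectral density $f_\ell$, that $f_1$ and $f_2$ are bounded on $\mathbb{R}^d$, and that the set $\{\lambda\in\mathbb{R}^d: f_1(\lambda)\ne f_2(\lambda)\}$ has positive Lebesgue measure. If the covariance functions $c_1$ and $c_2$ are uniformly continuous on $\mathbb{R}^d\times\mathbb{R}^d$ and $D$ is dense in $\mathbb{R}^d$, then the Gaussian measures $\mathbb{P}_1$ and $\mathbb{P}_2$ are orthogonal on $\sigma_D(\xi)$.
   Context: Setting. Let $d\ge 1$. Let $\mathbb{X}$ be the set of all functions $\mathbb{R}^d\to\mathbb{R}$ with the $\sigma$-algebra generated by the cylinder sets $\{s:(s(x_1),\dots,s(x_n))\in B\}$, $n\geq 1$, $x_i\in\mathbb{R}^d$, $B\subset\mathbb{R}^n$ Borel. Let $\xi:\Omega\to\mathbb{X}$ be a measurable map on a measurable space $(\Omega,\mathcal{F})$, i.e. a real random field $\{\xi_x:x\in\mathbb{R}^d\}$. Let $\mathbb{P}_1,\mathbb{P}_2$ be probability measures on $\mathcal{F}$ under each of which every vector $(\xi_{x_1},\dots,\xi_{x_n})$ is Gaussian. For $D\subset\mathbb{R}^d$, $\sigma_D(\xi)$ is the $\sigma$-algebra generated by $\{\xi_x:x\in D\}$. Standing assumptions: for $\ell=1,2$, $\xi$ has mean zero under $\mathbb{P}_\ell$; $\xi$ is stationary under $\mathbb{P}_\ell$, so its covariance function is $c_\ell(x,y)=\mathbb{E}_\ell[\xi_x\xi_y]=k_\ell(x-y)$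 for some $k_\ell:\mathbb{R}^d\to\mathbb{R}$; and there is a unique finite Borel measure $F_\ell$ on $\mathbb{R}^d$ (the spectral measure) with $c_\ell(x,y)=\int_{\mathbb{R}^d}e^{i\langle\lambda,x-y\rangle}F_\ell(d\lambda)$. If $F_\ell$ is absolutely continuous with respect to Lebesgue measure, its density $f_\ell$ is called the spectral density. $\mathbb{P}_1$ and $\mathbb{P}_2$ are orthogonal on $\sigma_D(\xi)$ if there is $A\in\sigma_D(\xi)$ with $\mathbb{P}_1(A)=0$ and $\mathbb{P}_2(A)=1$. *)

(* Defs.v *)
From HB Require Import structures.
From mathcomp Require Import all_boot all_order all_algebra.
From mathcomp Require Import all_classical all_reals all_analysis.
From mathcomp Require Import measurable_realfun complex.

Set Implicit Arguments.
Unset Strict Implicit.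
Unset Printing Implicit Defensive.

Import Order.TTheory GRing.Theory Num.Theory numFieldNormedType.Exports.

Local Open Scope classical_set_scope.
Local Open Scope ring_scope.

(* 'rV[R]_n carries the Borel sigma-algebra, generated by its open sets. *)
HB.instance Definition _ (R : realType) (n : nat) :=
  Measurable.copy 'rV[R]_n (g_sigma_algebraType (@open 'rV[R]_n)).

Section measurable_rV.
Context (R : realType) (n : nat).

Lemma measurable_coord (i : 'I_n) :
  measurable_fun setT (fun v : 'rV[R]_n => v ord0 i).
Proof.
apply: (measurability _ (RGenOpens.measurableE R)).
move=> _ [_ [a [b ->]] <-]; rewrite setTI; apply: sub_sigma_algebra.
apply: open_comp; last exact: itv_open.
by move=> v _; exact: coord_continuous.
Qed.

(* [box q r] : the open cube of centre q and radius r, with rational data *)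
Let box (qr : 'rV[rat]_n * rat) : set 'rV[R]_n :=
  [set v | forall i, `|v ord0 i - ratr (qr.1 ord0 i)| < ratr qr.2].

Let open_box (U : set 'rV[R]_n) : open U ->
  U = \bigcup_(qr in [set qr | box qr `<=` U]) box qr.
Proof.
move=> oU; apply/seteqP; split; last by move=> v [qr qrU]; exact: qrU.
move=> v Uv.
have /nbhs_ballP[e /= e0 eU] : nbhs v U by exact: open_nbhs_nbhs.
have /rat_in_itvoo[r] : 0 < e / 2 by rewrite divr_gt0.
rewrite in_itv/= => /andP[r0 re].
have /choice[q qP] : forall i : 'I_n, exists q : rat, `|v ord0 i - ratr q| < ratr r.
  move=> i; have /rat_in_itvoo[q] : v ord0 i - ratr r < v ord0 i + ratr r.
    by rewrite ltrBlDr -addrA ltrDl addr_gt0.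
  rewrite in_itv/= => /andP[q1 q2]; exists q.
  by rewrite distrC ltr_distl q1.
exists (\row_i q i, r); last by move=> i /=; rewrite mxE.
move=> w /= wqr; apply: eU; split => // k i; rewrite (ord1 k).
rewrite /ball /= -(subrKA (ratr (q i))).
rewrite (le_lt_trans (ler_normD _ _))// (splitr e) ltrD//.
  exact: lt_trans (qP i) re.
by rewrite distrC; apply: lt_trans re; have := wqr i; rewrite /= mxE.
Qed.

Lemma measurable_rVP d (T : measurableType d) (f : T -> 'rV[R]_n) :
  measurable_fun setT f <-> forall i, measurable_fun setT (fun t => f t ord0 i).
Proof.
split=> [mf i|mf].
  exact: measurableT_comp (measurable_coord i) mf.
apply: (measurability (@open 'rV[R]_n)) => //.
move=> _ [U oU <-]; rewrite setTI (open_box oU) preimage_bigcup.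
rewrite bigcup_mkcond; apply: countable_bigcupT_measurable => // qr.
case: ifPn => // _.
have -> : f @^-1` box qr = \bigcap_(i in [set: 'I_n])
    ((fun t => f t ord0 i) @^-1` [set x | `|x - ratr (qr.1 ord0 i)| < ratr qr.2]).
  by apply/seteqP; split => [t bt i _|t bt i]; [exact: bt|exact: (bt i)].
apply: fin_bigcap_measurable => [|i _]; first exact: finite_finset.
rewrite -[X in measurable X]setTI.
apply: mf => //.
have -> : [set x : R | `|x - ratr (qr.1 ord0 i)| < ratr qr.2] =
  `](ratr (qr.1 ord0 i) - ratr qr.2), (ratr (qr.1 ord0 i) + ratr qr.2)[%classic.
  by apply/seteqP; split => x /=; rewrite in_itv/= ltr_distl.
exact: measurable_itv.
Qed.

End measurable_rV.

(* Lebesgue measure on 'rV[R]_n, by iterating the product with the Lebesgue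
   measure on R along the identification R * R^n = R^(1 + n). *)
Section lebesgue_rV.
Context (R : realType).

Definition cons_rV n (xv : R * 'rV[R]_n) : 'rV[R]_n.+1 :=
  row_mx (const_mx xv.1 : 'rV_1) xv.2.

Definition uncons_rV n (v : 'rV[R]_n.+1) : R * 'rV[R]_n :=
  ((v : 'rV_(1 + n)) ord0 ord0, rsubmx (v : 'rV_(1 + n))).

Lemma cons_rVK n : cancel (@cons_rV n) (@uncons_rV n).
Proof.
move=> [x v]; congr pair; last exact: row_mxKr.
rewrite /cons_rV/= mxE; case: splitP => [j _|j]; first by rewrite mxE.
by move=> /eqP.
Qed.

Lemma uncons_rVK n : cancel (@uncons_rV n) (@cons_rV n).
Proof.
move=> v; rewrite /cons_rV /=.
rewrite (_ : const_mx _ = lsubmx (v : 'rV_(1 + n))); first exact: (@hsubmxK _ 1 1 n v).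
by apply/rowP => j; rewrite !mxE !ord1; congr (v _ _); exact/val_inj.
Qed.

Lemma measurable_cons_rV n : measurable_fun setT (@cons_rV n).
Proof.
apply/measurable_rVP => i; rewrite /cons_rV.
have [j ij|j ij] := @splitP 1 n i.
- have -> : i = lshift n j by exact/val_inj.
  rewrite [X in measurable_fun _ X](_ : _ = fst)//.
  apply/funext => -[x v] /=.
  by rewrite [LHS](@row_mxEl R 1 1 n (const_mx x) v ord0 j) mxE.
- have -> : i = rshift 1 j by exact/val_inj.
  rewrite [X in measurable_fun _ X](_ : _ = (fun v : 'rV[R]_n => v ord0 j) \o snd).
    exact: measurableT_comp (measurable_coord j) measurable_snd.
  apply/funext => -[x v] /=.
  exact: (@row_mxEr R 1 1 n (const_mx x) v ord0 j).
Qed.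

Lemma measurable_uncons_rV n : measurable_fun setT (@uncons_rV n).
Proof.
apply: measurable_fun_pair; first exact: measurable_coord.
apply/measurable_rVP => i.
rewrite [X in measurable_fun _ X](_ : _ =
  fun v : 'rV[R]_n.+1 => v ord0 (rshift 1 i)); first exact: measurable_coord.
by apply/funext => v; rewrite mxE.
Qed.

Section cons_measure.
Context (n : nat) (m : {sigma_finite_measure set 'rV[R]_n -> \bar R}).

Definition cons_measure : set 'rV[R]_n.+1 -> \bar R :=
  pushforward (@lebesgue_measure R \x m)%E (@cons_rV n).

Let cons_measure0 : cons_measure set0 = 0%E.
Proof. by rewrite /cons_measure /pushforward preimage_set0 measure0. Qed.

Let cons_measure_ge0 A : (0 <= cons_measure A)%E.
Proof. exact: (measure_ge0 (@lebesgue_measure R \x m)%E). Qed.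

Let cons_measure_sigma_additive : semi_sigma_additive cons_measure.
Proof.
have mpre (A : set 'rV[R]_n.+1) : measurable A -> measurable (@cons_rV n @^-1` A).
  by move=> mA; rewrite -[X in measurable X]setTI; exact: measurable_cons_rV.
move=> F mF tF mUF; rewrite /cons_measure /pushforward preimage_bigcup.
apply: measure_semi_sigma_additive; [by move=> k; exact: mpre| |].
- apply/trivIsetP => /= i j _ _ ij; rewrite -preimage_setI.
  by move/trivIsetP : tF => /(_ _ _ _ _ ij) ->//; rewrite preimage_set0.
- by rewrite -preimage_bigcup; exact: mpre.
Qed.

HB.instance Definition _ := isMeasure.Build _ _ _ cons_measure
  cons_measure0 cons_measure_ge0 cons_measure_sigma_additive.

Let cons_measure_sigma_finite : sigma_finite setT cons_measure.
Proof.
have /sigma_finiteP[F [TF ndF Foo]] := sigma_finiteT (@lebesgue_measure R).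
have /sigma_finiteP[G [TG ndG Goo]] := sigma_finiteT m.
exists (fun k => @uncons_rV n @^-1` (F k `*` G k)).
  apply/esym; rewrite -preimage_bigcup -subTset => v _ /=.
  have [k _ Fk] : (\bigcup_k F k) (uncons_rV v).1 by rewrite -TF.
  have [l _ Gl] : (\bigcup_k G k) (uncons_rV v).2 by rewrite -TG.
  exists (maxn k l) => //; split.
    by move: Fk; exact/subsetPset/ndF/leq_maxl.
  by move: Gl; exact/subsetPset/ndG/leq_maxr.
move=> k; have [mF Fk] := Foo k; have [mG Gk] := Goo k; split.
  rewrite -[X in measurable X]setTI; apply: measurable_uncons_rV => //.
  exact: measurableX.
rewrite /cons_measure /pushforward -comp_preimage.
rewrite (_ : _ \o _ = id); last by apply/funext/cons_rVK.
by rewrite [ltLHS]product_measure1E// lte_mul_pinfty// ge0_fin_numE.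
Qed.

HB.instance Definition _ := Measure_isSigmaFinite.Build _ _ _ cons_measure
  cons_measure_sigma_finite.

End cons_measure.

Fixpoint lebesgue_rV n : {sigma_finite_measure set 'rV[R]_n -> \bar R} :=
  match n with
  | 0 => \d_(0 : 'rV[R]_0)
  | n'.+1 => cons_measure (lebesgue_rV n')
  end.

Lemma lebesgue_rV_box n (a b : 'rV[R]_n) :
  (forall i, a ord0 i <= b ord0 i) ->
  lebesgue_rV n [set v | forall i, a ord0 i < v ord0 i <= b ord0 i] =
  (\prod_(i < n) (b ord0 i - a ord0 i))%:E.
Proof.
elim: n a b => [|n ih] a b ab.
  by rewrite big_ord0 /= diracE mem_set//; case.
pose a' := (uncons_rV a).2; pose b' := (uncons_rV b).2.
have liftE (v : 'rV[R]_n.+1) i : (uncons_rV v).2 ord0 i = v ord0 (lift ord0 i).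
  by rewrite mxE; congr (v _ _); exact/val_inj.
have cons0 x (v : 'rV[R]_n) : cons_rV (x, v) ord0 ord0 = x.
  rewrite -[RHS]/((x, v).1) -[in RHS](cons_rVK (x, v)) /=.
  by congr (cons_rV _ _ _); exact/val_inj.
have consS x (v : 'rV[R]_n) i : cons_rV (x, v) ord0 (lift ord0 i) = v ord0 i.
  by rewrite -liftE cons_rVK.
pose B := [set v : 'rV[R]_n | forall i, a' ord0 i < v ord0 i <= b' ord0 i].
have mB : measurable B.
  rewrite (_ : B = \bigcap_(i in [set: 'I_n])
      ((fun v : 'rV[R]_n => v ord0 i) @^-1` `]a' ord0 i, b' ord0 i])); last first.
    apply/seteqP; split => [v Bv i _|v Bv i]; first by rewrite /= in_itv; exact: Bv.
    by have := Bv i Logic.I; rewrite /= in_itv.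
  apply: fin_bigcap_measurable => [|i _]; first exact: finite_finset.
  by rewrite -[X in measurable X]setTI; exact: measurable_coord.
rewrite /= /cons_measure /pushforward (_ : _ @^-1` _ =
    `]a ord0 ord0, b ord0 ord0]%classic `*` B); last first.
  rewrite eqEsubset; split => -[x v] /=.
    move=> xv; split; rewrite /= ?in_itv/=.
      by have := xv ord0; rewrite cons0.
    by move=> i; rewrite !liftE; have := xv (lift ord0 i); rewrite consS.
  rewrite in_itv/= => -[xab Bv] i.
  case: (unliftP ord0 i) => [j ->|->].
    by rewrite consS -!liftE; exact: Bv.
  by rewrite cons0.
rewrite product_measure1E//= lebesgue_measure_itv/= lte_fin ih; last first.
  by move=> i; rewrite !liftE.
rewrite big_ord_recl EFinM; congr (_ * _)%E.
  by have := ab ord0; rewrite le_eqVlt => /predU1P[->|->]; rewrite ?ltxx ?subrr.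
by congr EFin; apply: eq_bigr => i _; rewrite !liftE.
Qed.

End lebesgue_rV.


Section complex_integral.
Local Open Scope complex_scope.

Definition expi (R : realType) (t : R) : R[i] := cos t +i* sin t.

Definition dot (R : realType) (n : nat) (u v : 'rV[R]_n) : R :=
  \sum_(i < n) u ord0 i * v ord0 i.

Definition cintegral d (T : measurableType d) (R : realType)
    (mu : {measure set T -> \bar R}) (f : T -> R[i]) : R[i] :=
  (\int[mu]_t complex.Re (f t)) +i* (\int[mu]_t complex.Im (f t)).

End complex_integral.

Section gaussian.
Context d (T : measurableType d) (R : realType) (P : probability T R).

(* The degenerate laws are the Dirac masses; they are listed apart because
   [normal_prob m 0] is not [\d_m] but, by convention, uniform on [0, 1]. *)
Definition gaussian_law (mu : set R -> \bar R) : Prop :=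
  (exists m : R, forall A : set R, measurable A -> mu A = \d_m A) \/
  (exists m s : R, 0 < s /\
     forall A : set R, measurable A -> mu A = normal_prob m s A).

Definition gaussian_vector n (X : T -> 'rV[R]_n) : Prop :=
  forall a : 'rV[R]_n, gaussian_law (pushforward P (fun w => dot a (X w))).

End gaussian.

Section random_field.
Context (R : realType) (d : nat).

Definition eval_at n (x : 'I_n -> 'rV[R]_d) (s : 'rV[R]_d -> R) : 'rV[R]_n :=
  \row_i s (x i).

Definition cylinders : set (set ('rV[R]_d -> R)) :=
  [set C | exists n (x : 'I_n.+1 -> 'rV[R]_d) (B : set 'rV[R]_n.+1),
    measurable B /\ C = [set s | B (eval_at x s)]].

Definition field_space := g_sigma_algebraType cylinders.
HB.instance Definition _ := Measurable.on field_space.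

Context disp (Omega : measurableType disp).
Implicit Types (P : probability Omega R) (xi : Omega -> 'rV[R]_d -> R).

Definition gaussian_field P xi : Prop :=
  forall n (x : 'I_n.+1 -> 'rV[R]_d),
    gaussian_vector P (fun w => eval_at x (xi w)).

Definition mean_zero P xi : Prop :=
  forall x, ('E_P[fun w => xi w x] = 0)%E.

Definition stationary P xi : Prop :=
  forall n (x : 'I_n.+1 -> 'rV[R]_d) (h : 'rV[R]_d) (B : set 'rV[R]_n.+1),
    measurable B ->
    P [set w | B (eval_at (fun i => x i + h) (xi w))] =
    P [set w | B (eval_at x (xi w))].

(* Not the library's [covariance], which is the same number for a centred
   field but subtracts the means. *)
Definition cov_fun P xi (x y : 'rV[R]_d) : R :=
  fine ('E_P[fun w => (xi w x * xi w y)%R])%E.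

Definition spectral_representation (F : {finite_measure set 'rV[R]_d -> \bar R})
    (c : 'rV[R]_d -> 'rV[R]_d -> R) : Prop :=
  forall x y, ((c x y)%:C)%C = cintegral F (fun l => expi (dot l (x - y))).

Definition spectral_measure (F : {finite_measure set 'rV[R]_d -> \bar R})
    (c : 'rV[R]_d -> 'rV[R]_d -> R) : Prop :=
  spectral_representation F c /\
  forall G : {finite_measure set 'rV[R]_d -> \bar R},
    spectral_representation G c ->
    forall A : set 'rV[R]_d, measurable A -> G A = F A.

Definition spectral_density (F : {finite_measure set 'rV[R]_d -> \bar R})
    (f : 'rV[R]_d -> R) : Prop :=
  [/\ measurable_fun setT f, forall l, 0 <= f l &
      forall A : set 'rV[R]_d, measurable A ->
        F A = (\int[lebesgue_rV R d]_(l in A) (f l)%:E)%E].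

Definition sigma_of_field xi (D : set 'rV[R]_d) : set (set Omega) :=
  <<s \bigcup_(x in D)
        preimage_set_system setT (fun w => xi w x) (@measurable _ R) >>.

Definition orthogonal_on P1 P2 (S : set (set Omega)) : Prop :=
  exists A, [/\ S A, P1 A = 0%E & P2 A = 1%E].

End random_field.

(* Main.v *)
Require Import Defs.
From HB Require Import structures.
From mathcomp Require Import all_boot all_order all_algebra.
From mathcomp Require Import all_classical all_reals all_analysis.
From mathcomp Require Import measurable_realfun complex ring lra.

(* Since the two spectral densities differ on a set of positive measure,
   uniqueness of the spectral measure yields a vector h for which the variances
   rho_l of xi_x + xi_(x + h) under P_l differ. Put U_i = xi_(i e) + xi_(i e + h),
   e the first basis vector. The sequence U_i is stationary and Gaussian, and
   its spectral measure has no atoms because hyperplanes are Lebesgue null. By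
   Isserlis' formula the variance of T_N = (U_0^2 + ... + U_(N-1)^2) / N is
   2 / N^2 times the sum of the squared covariances of the U_i, U_j, which
   tends to 0 by Wiener's lemma; hence T_N -> rho_l in L^2(P_l). Uniform
   continuity of the covariances allows the points i e and i e + h to be moved
   into D at an arbitrarily small cost. By Chebyshev's inequality the events
   |T_N - rho_2| < |rho_1 - rho_2| / 2 can thus be given P_1-probability at most
   2^-m and P_2-probability at least 1 - 2^-m, and the limit superior of such a
   sequence of events separates P_1 from P_2. *)

Set Implicit Arguments.
Unset Strict Implicit.
Unset Printing Implicit Defensive.

Import Order.TTheory GRing.Theory Num.Theory numFieldNormedType.Exports.

Local Open Scope classical_set_scope.
Local Open Scope ring_scope.

(** * Moments of Gaussian laws *)

(** The quotient y^k / k! is one of the nonnegative terms of the exponential series. *)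
Lemma exprn_le_fact_expR (R : realType) (k : nat) (y : R) :
  0 <= y -> y ^+ k <= k`!%:R * expR y.
Proof.
move=> y0; case: k => [|k].
  by rewrite expr0 fact0 mul1r -expR0 ler_expR.
rewrite mulrC -ler_pdivrMr ?ltr0n ?fact_gt0//.
by apply: le_trans (expR_ge1Dxn k y0); rewrite lerDr.
Qed.

(** With t = |u|^k this is t <= 1 + t^2. It reduces arbitrary powers of u to powers of u^2, the
    quantity in the Gaussian exponent. *)
Lemma normr_exprn_le1D (R : realType) (u : R) k : `|u| ^+ k <= 1 + (u ^+ 2) ^+ k.
Proof.
rewrite exprAC -[(u ^+ k) ^+ 2]real_normK ?num_real// normrX.
set t := `|u| ^+ k; rewrite -subr_ge0.
have := sqr_ge0 (t - 1/2); nra.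
Qed.

Lemma normal_fun_sqrt2 (R : realType) (m s x : R) :
  normal_fun m s x = normal_fun m (s * Num.sqrt 2) x ^+ 2.
Proof.
rewrite /normal_fun -expRM_natl; congr expR.
rewrite exprMn sqr_sqrtr ?ler0n//.
have [->|s0] := eqVneq s 0; first by rewrite expr0n/= mul0r !mul0rn invr0 !mulr0.
by field.
Qed.

(* Half of the Gaussian exponent absorbs the polynomial factor; the other half,
   a Gaussian of standard deviation [s * sqrt 2], remains integrable. *)
Lemma exprn_normal_fun_le (R : realType) (m s : R) (k : nat) : 0 < s ->
  exists2 C : R, 0 <= C & forall x,
    `|x - m| ^+ k * normal_fun m s x <= C * normal_fun m (s * Num.sqrt 2) x.
Proof.
(* Put y = u^2 / (4 s^2). The summand 1 is absorbed by 1 <= expR y, and (u^2)^k = (4 s^2)^k y^k by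
   y^k <= k! expR y. *)
move=> s0; exists (1 + (4 * s ^+ 2) ^+ k * k`!%:R).
  by rewrite addr_ge0// mulr_ge0// exprn_ge0// mulr_ge0// sqr_ge0.
move=> x; set u := x - m; set y := u ^+ 2 / (4 * s ^+ 2).
have y0 : 0 <= y by rewrite divr_ge0 ?sqr_ge0// mulr_ge0// sqr_ge0.
have nE : normal_fun m (s * Num.sqrt 2) x = (expR y)^-1.
  rewrite -expRN /normal_fun; congr expR.
  rewrite exprMn sqr_sqrtr ?ler0n// /y -/u.
  by field; rewrite gt_eqF.
rewrite normal_fun_sqrt2 nE expr2 mulrA ler_pM2r ?invr_gt0 ?expR_gt0//.
rewrite ler_pdivrMr ?expR_gt0//.
apply: le_trans (normr_exprn_le1D u k) _.
rewrite mulrDl mul1r lerD//.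
  by rewrite -expR0 ler_expR.
have -> : u ^+ 2 = (4 * s ^+ 2) * y.
  by rewrite /y mulrC divfK// gt_eqF// mulr_gt0// exprn_gt0.
rewrite exprMn -mulrA.
by rewrite ler_wpM2l ?exprn_ge0 ?mulr_ge0 ?sqr_ge0 ?exprn_le_fact_expR ?(ltW s0).
Qed.

Lemma integrable_exprn_normal_fun (R : realType) (m s : R) (k : nat) : 0 < s ->
  lebesgue_measure.-integrable [set: R]
    (fun x => ((x - m) ^+ k * normal_fun m s x)%:E).
Proof.
move=> s0; have [C C0 CP] := exprn_normal_fun_le m k s0.
have s20 : s * Num.sqrt 2 != 0 by rewrite gt_eqF// mulr_gt0// sqrtr_gt0.
pose D := C / normal_peak (s * Num.sqrt 2).
apply: (@le_integrable _ _ _ lebesgue_measure setT measurableT _ (fun x => (D *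
  normal_pdf m (s * Num.sqrt 2) x)%:E)).
- apply/measurable_EFinP; apply: measurable_funM.
    by apply: measurable_funX; exact: measurable_funB.
  exact: measurable_normal_fun.
- move=> x _; rewrite /= lee_fin normrM normrX (ger0_norm (normal_fun_ge0 _ _ _)).
  apply: le_trans (CP x) _; apply: le_trans (ler_norm _).
  rewrite normal_pdfE// /D mulrA divfK//.
  by rewrite gt_eqF// normal_peak_gt0.
- under eq_fun do rewrite EFinM.
  apply: integrableZl => //.
  exact: integrable_normal_pdf.
Qed.

(** As n <= n^2, the values are dominated by a geometric sequence of ratio exp(-1 / (2 s^2)). *)
Lemma cvg_normal_fun0 (R : realType) (m s : R) : 0 < s ->
  normal_fun m s (m + n%:R) @[n --> \oo] --> 0.
Proof.
move=> s0; pose c := (s ^+ 2 *+ 2).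
have c0 : 0 < c by rewrite mulrn_wgt0// exprn_gt0.
apply: (@squeeze_cvgr _ _ _ _ (cst 0) (fun n => expR (- c^-1) ^+ n)).
- apply: nearW => n; rewrite normal_fun_ge0/= /normal_fun.
  rewrite -expRM_natl ler_expR addrAC subrr add0r -/c mulNr mulrN lerN2.
  rewrite ler_wpM2r ?invr_ge0 ?(ltW c0)// -natrX ler_nat.
  by case: n => // n; rewrite -{1}(expn1 n.+1) leq_pexp2l.
- exact: cvg_cst.
- apply: cvg_expr; rewrite ger0_norm ?expR_ge0// -expR0 ltr_expR.
  by rewrite oppr_lt0 invr_gt0.
Qed.

Lemma is_derive_normal_fun (R : realType) (m s x : R) : s != 0 ->
  is_derive x 1 (normal_fun m s) (- ((x - m) / s ^+ 2) * normal_fun m s x).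
Proof.
move=> s0.
have dg : is_derive x 1 (fun y : R => - (y - m) ^+ 2 / (s ^+ 2 *+ 2)) (- ((x - m) /
  s ^+ 2)).
  rewrite (_ : (fun _ => _) = (- (s ^+ 2 *+ 2)^-1) \*: ((id - cst m) ^+ 2 : R ->
    R)); last first.
    by apply/funext => y /=; rewrite !fctE /= mulNr mulrC -mulNr.
  apply: is_derive_eq.
  rewrite /= !fctE /GRing.scale /= expr1 subr0.
  by field.
have := @is_derive1_comp _ expR (fun y : R => - (y - m) ^+ 2 / (s ^+ 2 *+ 2)) x _ _
  (is_derive_expR _) dg.
by move=> h; apply: is_derive_eq h _; rewrite mulrC.
Qed.

(** For k = 0 the truncated exponent [k.-1] does no harm, since its term carries the factor k. *)
Lemma is_derive_exprn_normal_fun (R : realType) (m s x : R) k : s != 0 ->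
  is_derive x 1 (fun x => (x - m) ^+ k * normal_fun m s x)
    (k%:R * ((x - m) ^+ k.-1 * normal_fun m s x)
     - s ^- 2 * ((x - m) ^+ k.+1 * normal_fun m s x)).
Proof.
move=> s0; have ? := is_derive_normal_fun m x s0.
rewrite (_ : (fun _ => _) = ((id - cst m : R -> R) ^+ k) * normal_fun m s); last first.
  by apply/funext => y; rewrite !fctE.
apply: is_derive_eq.
rewrite /= !fctE /GRing.scale /= subr0 mulr1 (exprS (x - m)).
move: (s ^+ 2)^-1 ((x - m) ^+ k.-1) (normal_fun m s x) => c a b; by ring.
Qed.

Lemma continuous_exprn_normal_fun (R : realType) (m s : R) k : s != 0 ->
  continuous (fun x => (x - m) ^+ k * normal_fun m s x).
Proof.
move=> s0 x; have [d _] := is_derive_exprn_normal_fun m x k s0.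
by apply: differentiable_continuous; rewrite -derivable1_diffP.
Qed.

(** The sign e = 1 or -1 treats both ends of the line at once, because [normal_fun] is even about
    m. *)
Lemma cvg_exprn_normal_fun0 (R : realType) (m s e : R) k : 0 < s ->
  `|e| = 1 ->
  (e * n%:R) ^+ k * normal_fun m s (m + e * n%:R) @[n --> \oo] --> 0.
Proof.
move=> s0 e1; have [C C0 CP] := exprn_normal_fun_le m k s0.
have e2 : e ^+ 2 = 1 by rewrite -[e ^+ 2]real_normK ?num_real// e1 expr1n.
have h : C * normal_fun m (s * Num.sqrt 2) (m + n%:R) @[n --> \oo] --> 0.
  rewrite -[X in _ --> X](mulr0 C); apply: cvgM; first exact: cvg_cst.
  by apply: cvg_normal_fun0; rewrite mulr_gt0// sqrtr_gt0.
have nE s' n : normal_fun m s' (m + e * n%:R) = normal_fun m s' (m + n%:R).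
  by rewrite /normal_fun !(addrC m) !addrK exprMn e2 mul1r.
apply/norm_cvg0P; apply: (@squeeze_cvgr _ _ _ _ (cst 0)); [| |exact: h].
- apply: nearW => n; rewrite normr_ge0/= -nE.
  rewrite normrM normrX (ger0_norm (normal_fun_ge0 _ _ _)).
  by have := CP (m + e * n%:R); rewrite addrAC subrr add0r.
- exact: cvg_cst.
Qed.

(* Integration by parts: the function whose derivative appears below is
   [(x - m) ^+ k * normal_fun m s x], which vanishes at infinity. *)
Lemma Rintegral_exprnS_normal_fun (R : realType) (m s : R) k : 0 < s ->
  \int[lebesgue_measure]_x ((x - m) ^+ k.+1 * normal_fun m s x) =
  s ^+ 2 * k%:R * \int[lebesgue_measure]_x ((x - m) ^+ k.-1 * normal_fun m s x).
Proof.
move=> s0; have sN0 : s != 0 by rewrite gt_eqF.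
pose F (x : R) := (x - m) ^+ k * normal_fun m s x.
pose f (x : R) := k%:R * ((x - m) ^+ k.-1 * normal_fun m s x)
     - s ^- 2 * ((x - m) ^+ k.+1 * normal_fun m s x).
have dF (x : R) : is_derive x 1 F (f x) by exact: is_derive_exprn_normal_fun.
have cF : continuous F by exact: continuous_exprn_normal_fun.
have cf : continuous f.
  move=> x; apply: cvgB; (apply: cvgM; first exact: cvg_cst);
    exact: continuous_exprn_normal_fun.
pose mu := @lebesgue_measure R.
have i1 j : mu.-integrable setT (EFin \o (fun x => (x - m) ^+ j * normal_fun m s x)).
  exact: integrable_exprn_normal_fun.
have i2 j c : mu.-integrable setT (EFin \o (fun x => c * ((x - m) ^+ j * normal_fun
  m s x))).
  rewrite (_ : _ \o _ = (fun x => c%:E * ((x - m) ^+ j * normal_fun m s x)%:E)%E)//.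
  by apply: integrableZl; [exact: measurableT|exact: i1].
have if_ : mu.-integrable setT (EFin \o f).
  rewrite (_ : _ \o _ = ((EFin \o (fun x => k%:R * ((x - m) ^+ k.-1 * normal_fun m s
    x))%R) \-
      (EFin \o (fun x => s ^- 2 * ((x - m) ^+ k.+1 * normal_fun m s x))%R))%E).
    by apply: integrableB; [exact: measurableT|exact: i2|exact: i2].
  by apply/funext => x; rewrite /= EFinB.
have mf : measurable_fun setT f by apply/measurable_EFinP; exact: measurable_int if_.
(* The integral of f over I n is computed in two ways: dominated convergence sends it to the
   integral of f, the fundamental theorem to 0. The successor keeps I 0 nondegenerate. *)
pose I (n : nat) : set R := `[m - n.+1%:R, m + n.+1%:R]%classic.
have IE n : (\int[mu]_x ((f \_ (I n)) x)%:E = (F (m + n.+1%:R) - F (m - n.+1%:R))%:E)%E.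
  transitivity (\int[mu]_(x in I n) (f x)%:E)%E.
    by rewrite [RHS]integral_mkcond restrict_EFin.
  rewrite (@continuous_FTC2 _ f F)//.
  - by rewrite ltrD2l gtrN.
  - exact: continuous_subspaceT.
  - split; first by move=> x _; have [] := dF x.
    + exact/cvg_at_right_filter/cF.
    + exact/cvg_at_left_filter/cF.
  - by move=> x _; rewrite derive1E; have [_ ->] := dF x.
have [] := @dominated_convergence _ _ _ mu setT measurableT
  (fun n x => ((f \_ (I n)) x)%:E) (EFin \o f) (fun x => `|f x|%:E).
- move=> n; apply/measurable_EFinP; apply/(measurable_restrictT _ _).1;
  first exact: measurable_itv.
  exact: measurable_funTS.
- exact: measurable_int if_.
- apply: aeW => x _; apply: cvg_near_cst.
  near=> n; rewrite /patch mem_set// /I /= in_itv/=.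
  have : `|x - m| <= n.+1%:R.
    near: n; exists (Num.trunc `|x - m|) => // n /= hn.
    apply/ltW/(lt_le_trans (truncnS_gt _)).
    by rewrite ler_nat ltnS.
  by rewrite ler_distl.
- by have := integrable_abse if_; apply: eq_integrable.
- apply: aeW => x n _; rewrite /= lee_fin /patch; case: ifP => // _.
  by rewrite normr0.
move=> _ _ lim1.
have lim2 : (fun n => \int[mu]_x ((f \_ (I n)) x)%:E)%E @ \oo --> 0%:E.
  rewrite (_ : (fun _ => _) = EFin \o (fun n => F (m + n.+1%:R) - F (m - n.+1%:R)));
    last first.
    by apply/funext.
  apply: cvg_EFin; first exact: nearW.
  rewrite -[X in _ --> X](subrr 0); apply: cvgB.
    have := cvg_exprn_normal_fun0 m k s0 (normr1 R).
    rewrite -cvg_shiftS; apply: cvg_trans; apply: near_eq_cvg.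
    by apply: nearW => n; rewrite /F /= mul1r addrAC subrr add0r.
  have := cvg_exprn_normal_fun0 m k s0 (normrN1 R).
  rewrite -cvg_shiftS; apply: cvg_trans; apply: near_eq_cvg.
  by apply: nearW => n; rewrite /F /= mulN1r addrAC subrr add0r.
have : (\int[mu]_x (EFin \o f) x = 0)%E.
  by apply: cvg_unique lim1 lim2.
move=> /(congr1 fine); rewrite -/(Rintegral mu setT f) /f RintegralB// !RintegralZl//.
move/eqP; rewrite subr_eq0 => /eqP h.
rewrite -/mu -mulrA h mulrA divff ?mul1r// expf_neq0//.
Unshelve. all: by end_near.
Qed.

(** * Expectations of functions of a Gaussian variable *)

Section gaussian_law.
Context (R : realType).
Local Notation mu := (@lebesgue_measure R).

(** The Radon-Nikodym derivative of [normal_prob] and [normal_pdf] have the same integral over every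
    measurable set, hence agree almost everywhere. *)
Lemma ge0_integral_normal_prob (m s : R) (g : R -> \bar R) :
  measurable_fun setT g -> (forall x, 0 <= g x)%E ->
  (\int[normal_prob m s]_x g x = \int[mu]_x (g x * (normal_pdf m s x)%:E))%E.
Proof.
move=> mg g0.
have dom := normal_prob_dominates m s.
rewrite -(Radon_Nikodym_SigmaFinite.change_of_variables dom g0 measurableT mg).
have mf := measurable_int _ (Radon_Nikodym_SigmaFinite.f_integrable dom).
apply: ae_eq_integral => //.
- exact: emeasurable_funM.
- by apply: emeasurable_funM => //; apply/measurable_EFinP; exact: measurable_normal_pdf.
- apply: ae_eqe_mul2l; apply: integral_ae_eq => //=.
  + exact: Radon_Nikodym_SigmaFinite.f_integrable.
  + by apply/measurable_EFinP; exact: measurable_normal_pdf.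
  + by move=> E _ mE; rewrite -Radon_Nikodym_SigmaFinite.f_integral.
Qed.

Context d (T : measurableType d) (P : probability T R) (L : T -> R).
Hypothesis mL : measurable_fun setT L.

(** The nonnegative case [key] is applied to |g| for integrability, then to the positive and
    negative parts of g. *)
Lemma normal_law_integral (m s : R) (g : R -> R) :
  (forall A : set R, measurable A -> pushforward P L A = normal_prob m s A) ->
  measurable_fun setT g ->
  mu.-integrable setT (fun x => (g x * normal_pdf m s x)%:E) ->
  P.-integrable setT (EFin \o (g \o L)) /\
  \int[P]_w g (L w) = \int[mu]_x (g x * normal_pdf m s x).
Proof.
move=> PL mg ig.
(* [R] and [measurableTypeR R] carry the same sigma-algebra with different
   displays; the law of [L] must be read on the type of the Lebesgue measure. *)
have mL' : measurable_fun setT (L : T -> measurableTypeR R) by exact: mL.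
pose L' : {mfun T >-> measurableTypeR R} := HB.pack (L : T -> measurableTypeR R)
  (isMeasurableFun.Build _ _ _ _ _ mL').
have key (h : R -> \bar R) : measurable_fun setT h -> (forall x, 0 <= h x)%E ->
    (\int[P]_w h (L w) = \int[mu]_x (h x * (normal_pdf m s x)%:E))%E.
  move=> mh h0; rewrite -ge0_integral_normal_prob//.
  transitivity (\int[pushforward P L']_x h x)%E; first by rewrite
    ge0_integral_pushforward.
  by apply: (@eq_measure_integral _ (measurableTypeR R) R setT (normal_prob m s)
    (pushforward P L')) => A mA _; exact: PL.
have mgE : measurable_fun setT (EFin \o g) by exact/measurable_EFinP.
have mgL : measurable_fun setT (EFin \o (g \o L)).
  by apply/measurable_EFinP; exact: measurableT_comp.
split.
  apply/integrableP; split => //.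
  have E : (\int[P]_w `|(g (L w))%:E| = \int[mu]_x (`|(g x)%:E| * (normal_pdf m s
    x)%:E))%E.
    by apply: (key (fun x => `|(g x)%:E|%E)) => //; exact: measurableT_comp.
  rewrite [X in (X < _)%E]E.
  have /integrableP[_] := ig; congr (_ < _)%E; apply: eq_integral => x _.
  rewrite -[LHS]/(`|g x * normal_pdf m s x : R|%:E) normrM.
  by rewrite [X in _ * X]ger0_norm ?normal_pdf_ge0.
have pdf0 x : (0 <= (normal_pdf m s x)%:E)%E by rewrite lee_fin normal_pdf_ge0.
have Ep := key _ (measurable_funepos mgE) (fun x => funepos_ge0 (EFin \o g) x).
have En := key _ (measurable_funeneg mgE) (fun x => funeneg_ge0 (EFin \o g) x).
rewrite /Rintegral; congr fine; rewrite integralE [RHS]integralE; congr (_ - _)%E.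
  transitivity (\int[P]_w ((EFin \o g)^\+ (L w)))%E;
    first by apply: eq_integral => w _; rewrite !funeposE.
  rewrite Ep; apply: eq_integral => x _; rewrite !funeposE /= EFinM.
  by rewrite muleC maxe_pMr// mule0 muleC.
transitivity (\int[P]_w ((EFin \o g)^\- (L w)))%E;
  first by apply: eq_integral => w _; rewrite !funenegE.
rewrite En; apply: eq_integral => x _; rewrite !funenegE.
transitivity (maxe ((normal_pdf m s x)%:E * - (g x)%:E) 0)%E.
  by rewrite muleC maxe_pMr// mule0.
by rewrite muleN -EFinM mulrC.
Qed.

Lemma dirac_law_integral (m : R) (g : R -> R) :
  (forall A : set R, measurable A -> pushforward P L A = \d_m A) ->
  measurable_fun setT g ->
  P.-integrable setT (EFin \o (g \o L)) /\ \int[P]_w g (L w) = g m.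
Proof.
move=> PL mg.
pose L' : {mfun T >-> R} := HB.pack L (isMeasurableFun.Build _ _ _ _ L mL).
have mgL : measurable_fun setT (EFin \o (g \o L)).
  by apply/measurable_EFinP; exact: measurableT_comp.
have mgE : measurable_fun setT (EFin \o g) by exact/measurable_EFinP.
have ig : P.-integrable setT (EFin \o (g \o L)).
  apply/integrableP; split => //.
  have -> : (\int[P]_w `|(EFin \o (g \o L)) w| = \int[pushforward P L']_x `|(g x)%:E|)%E.
    by rewrite ge0_integral_pushforward//; exact: measurableT_comp.
  rewrite (@eq_measure_integral _ _ _ setT \d_m); last by move=> A mA _; exact: PL.
  rewrite integral_dirac//; last exact: measurableT_comp.
  by rewrite diracT mul1e ltry.
split => //; rewrite /Rintegral.
have -> : (\int[P]_w (g (L w))%:E = \int[pushforward P L']_x (g x)%:E)%E.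
  by rewrite integral_pushforward.
rewrite (@eq_measure_integral _ _ _ setT \d_m); last by move=> A mA _; exact: PL.
by rewrite integral_dirac// diracT mul1e.
Qed.

Hypothesis gL : gaussian_law (pushforward P L).

Let integrable_pdf (m s : R) k : 0 < s ->
  mu.-integrable setT (fun x => ((x - m) ^+ k * normal_pdf m s x)%:E).
Proof.
move=> s0; rewrite normal_pdfE ?gt_eqF//.
rewrite (_ : (fun _ => _) = (fun x => (normal_peak s)%:E * ((x - m) ^+ k *
  normal_fun m s x)%:E)%E).
  by apply: integrableZl; [exact: measurableT|exact: integrable_exprn_normal_fun].
by apply/funext => x; rewrite -EFinM mulrCA.
Qed.

Let Rintegral_pdf (m s : R) k : 0 < s ->
  \int[mu]_x ((x - m) ^+ k * normal_pdf m s x) =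
  normal_peak s * \int[mu]_x ((x - m) ^+ k * normal_fun m s x).
Proof.
move=> s0; rewrite normal_pdfE ?gt_eqF// -RintegralZl//;
  last exact: integrable_exprn_normal_fun.
by apply: eq_Rintegral => x _; rewrite mulrCA.
Qed.

Let pdf_moment (m s : R) k : 0 < s ->
  \int[mu]_x ((x - m) ^+ k.+1 * normal_pdf m s x) =
  s ^+ 2 * k%:R * \int[mu]_x ((x - m) ^+ k.-1 * normal_pdf m s x).
Proof.
by move=> s0; rewrite !Rintegral_pdf// Rintegral_exprnS_normal_fun// mulrCA.
Qed.

Lemma gaussian_law_integrable : P.-integrable setT (EFin \o L).
Proof.
case: gL => [[m Pm]|[m [s [s0 Pm]]]].
  by have [] := @dirac_law_integral m id Pm (@measurable_id _ _ setT).
have mXm : measurable_fun setT (fun x : R => x - m) by exact: measurable_funB.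
have [h _] := @normal_law_integral m s (fun x => x - m) Pm mXm (@integrable_pdf m s 1 s0).
rewrite (_ : _ \o _ = ((EFin \o ((fun x => x - m)%R \o L)) \+ cst m%:E)%E).
  by apply: integrableD => //; exact: finite_measure_integrable_cst.
by apply/funext => w /=; rewrite -EFinD subrK.
Qed.

Hypothesis L0 : \int[P]_w L w = 0.

(** The first central moment of the normal law vanishes, by [pdf_moment] with k = 0; it also equals
    the mean of L minus m, that is -m. *)
Let normal_law_mean0 m s : 0 < s ->
  (forall A : set R, measurable A -> pushforward P L A = normal_prob m s A) -> m = 0.
Proof.
move=> s0 Pm; have mXm : measurable_fun setT (fun x : R => x - m) by exact:
  measurable_funB.
have [_] := @normal_law_integral m s (fun x => x - m) Pm mXm (@integrable_pdf m s 1 s0).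
rewrite RintegralB//; first last.
  exact: finite_measure_integrable_cst.
  exact: gaussian_law_integrable.
rewrite L0 Rintegral_cst// [X in fine X]probability_setT mulr1 sub0r.
have /= := @pdf_moment m s 0 s0; under eq_Rintegral do rewrite expr1.
by move=> ->; rewrite mulr0 mul0r => /eqP; rewrite oppr_eq0 => /eqP.
Qed.

Let normal_law_exprn m s k : 0 < s ->
  (forall A : set R, measurable A -> pushforward P L A = normal_prob m s A) ->
  P.-integrable setT (EFin \o (fun w => L w ^+ k)) /\
  \int[P]_w (L w ^+ k) = \int[mu]_x ((x - 0) ^+ k * normal_pdf 0 s x).
Proof.
move=> s0 Pm; have m0 := normal_law_mean0 s0 Pm; subst m.
have [] := @normal_law_integral 0 s (fun x => (x - 0) ^+ k) Pm _ (@integrable_pdf 0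
  s k s0).
  by apply: measurable_funX; exact: measurable_funB.
by move=> h1 h2; split; [apply: eq_integrable h1 => //|rewrite -h2; apply: eq_Rintegral];
  move=> w _ /=; rewrite subr0.
Qed.

Lemma gaussian_law_integrable_exprn k : P.-integrable setT (EFin \o (fun w => L w ^+ k)).
Proof.
case: gL => [[m Pm]|[m [s [s0 Pm]]]].
  by have [] := @dirac_law_integral m (fun x => x ^+ k) Pm (exprn_measurable k).
by have [] := normal_law_exprn k s0 Pm.
Qed.

(** Two uses of the recursion give s^2 for the second moment and 3 s^2 times it for the fourth. A
    Dirac law of mean zero sits at 0, where both sides vanish. *)
Lemma gaussian_law_moment4 :
  \int[P]_w (L w ^+ 4) = 3 * (\int[P]_w (L w ^+ 2)) ^+ 2.
Proof.
case: gL => [[m Pm]|[m [s [s0 Pm]]]].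
  have h k := (@dirac_law_integral m (fun x => x ^+ k) Pm (exprn_measurable k)).2.
  have m0 : m = 0 by have := h 1; rewrite -L0 expr1 => <-;
    apply: eq_Rintegral => w _; rewrite expr1.
  by rewrite !h m0; ring.
rewrite (normal_law_exprn 4 s0 Pm).2 (normal_law_exprn 2 s0 Pm).2.
rewrite (@pdf_moment 0 s 3 s0) /= (@pdf_moment 0 s 1 s0)/=.
under eq_Rintegral do rewrite expr0 mul1r.
by rewrite /Rintegral integral_normal_pdf /=; ring.
Qed.

End gaussian_law.

(** * Wiener's lemma *)

Section Rintegral_extra.
Context d (T : measurableType d) (R : realType).

Lemma Rintegral_sum (mu : {measure set T -> \bar R}) (I : Type) (s : seq I)
    (f : I -> T -> R) :
  (forall i, mu.-integrable setT (EFin \o f i)) ->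
  mu.-integrable setT (EFin \o (fun x => \sum_(i <- s) f i x)) /\
  \int[mu]_x (\sum_(i <- s) f i x) = \sum_(i <- s) \int[mu]_x (f i x).
Proof.
move=> fi; elim: s => [|i s [ih1 ih2]].
  split; last by rewrite big_nil; under eq_Rintegral do rewrite big_nil;
    rewrite Rintegral_cst// mul0r.
  rewrite (_ : _ \o _ = cst 0%E); first exact: integrable0.
  by apply/funext => x /=; rewrite big_nil.
split.
  rewrite (_ : _ \o _ = ((EFin \o f i) \+ (EFin \o (fun x => \sum_(i <- s) f i x)%R))%E).
    by apply: integrableD; [exact: measurableT|exact: fi|exact: ih1].
  by apply/funext => x /=; rewrite big_cons EFinD.
rewrite big_cons -ih2 -RintegralD//.
by apply: eq_Rintegral => x _; rewrite big_cons.
Qed.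

Variable mu : {finite_measure set T -> \bar R}.

Lemma finite_bounded_integrable (f : T -> R) (M : R) :
  measurable_fun setT f -> (forall x, `|f x| <= M) ->
  mu.-integrable setT (EFin \o f).
Proof.
move=> mf fM; apply: measurable_bounded_integrable => //.
  by rewrite -ge0_fin_numE// fin_num_measure.
exists M; split; first exact: num_real.
by move=> y My x _; apply: le_trans (fM x) (ltW My).
Qed.

Lemma cvg_Rintegral_bounded0 (f : nat -> T -> R) (M : R) :
  (forall n, measurable_fun setT (f n)) -> (forall n x, `|f n x| <= M) ->
  {ae mu, forall x, f n x @[n --> \oo] --> 0} ->
  \int[mu]_x (f n x) @[n --> \oo] --> 0.
Proof.
move=> mf fM f0.
have [] := @dominated_convergence _ _ _ mu setT measurableT
  (fun n => EFin \o f n) (cst 0%E) (cst M%:E).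
- by move=> n; exact/measurable_EFinP.
- exact: measurable_cst.
- by apply: filterS f0 => x fx _; apply: cvg_EFin => //; exact: nearW.
- rewrite (_ : cst _ = EFin \o cst M)//.
  by apply: (@finite_bounded_integrable _ `|M|).
- by apply: aeW => x n _; rewrite /= lee_fin.
move=> _ _; rewrite integral0 => h.
exact: (fine_cvg h).
Qed.

End Rintegral_extra.

(** * The Fejér kernel *)

Section fejer.
Context (R : realType).
Implicit Types x t : R.

(** Subtracting a multiple of pi brings x to some y in [0, pi[, where sin vanishes only at 0. *)
Lemma sin_eq0_int x : sin x = 0 -> exists k : int, x = k%:~R * pi.
Proof.
move=> sx; pose k := Num.floor (x / pi); exists k.
pose y := x - k%:~R * pi.
have xE : x = y + k%:~R * pi by rewrite subrK.
have y0 : 0 <= y.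
  by rewrite subr_ge0 -ler_pdivlMr ?pi_gt0// floor_le_tmp.
have ypi : y < pi.
  rewrite ltrBlDr -[X in X + _](mul1r pi) -mulrDl -ltr_pdivrMr ?pi_gt0//.
  by rewrite addrC -[1]/(1%:~R) -intrD floorD1_gt.
have sy : sin y = 0.
  (* [alternatingn] shifts by natural multiples of pi only: it is applied at y when k >= 0 and at x
     when k < 0. *)
  rewrite /y; case: (k) => n.
    have := alternatingn (@sinDpi R) n (x - (Posz n)%:~R * pi).
    rewrite -mulr_natl subrK sx => /esym/eqP.
    by rewrite mulf_eq0 signr_eq0 => /eqP.
  have := alternatingn (@sinDpi R) n.+1 x.
  by rewrite sx mulr0 NegzE mulrNz mulNr opprK -mulr_natl.
have : y = 0.
  apply/eqP; rewrite eq_le y0 andbT leNgt; apply/negP => yp.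
  by have := @sin_gt0_pi R y; rewrite yp ypi sy ltxx => /(_ isT).
by move=> yE; rewrite {1}xE yE add0r.
Qed.

(** The unnormalized Fejér kernel |sum_(j < N) exp(i j t)|^2. *)
Definition fejer (N : nat) t : R :=
  \sum_(i < N) \sum_(j < N) cos ((i%:R - j%:R) * t).

Lemma fejerE N t :
  fejer N t = (\sum_(i < N) cos (i%:R * t)) ^+ 2 + (\sum_(i < N) sin (i%:R * t)) ^+ 2.
Proof.
rewrite !expr2 !mulr_suml -big_split; apply: eq_bigr => i _ /=.
rewrite !mulr_sumr -big_split; apply: eq_bigr => j _ /=.
by rewrite mulrBl cosB.
Qed.

(** Telescoping: 2 sin(t/2) cos(i t) = sin((i + 1/2) t) - sin((i - 1/2) t). *)
Lemma sum_cos_half N t :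
  2 * sin (t / 2) * \sum_(i < N) cos (i%:R * t) = sin (N%:R * t - t / 2) + sin (t / 2).
Proof.
elim: N => [|N ih]; first by rewrite big_ord0 mulr0 mul0r sub0r sinN addNr.
rewrite big_ord_recr/= mulrDr ih.
rewrite (_ : N.+1%:R * t - t / 2 = N%:R * t + t / 2); last by rewrite -natr1; field.
rewrite sinB sinD; ring.
Qed.

Lemma sum_sin_half N t :
  2 * sin (t / 2) * \sum_(i < N) sin (i%:R * t) = cos (t / 2) - cos (N%:R * t - t / 2).
Proof.
elim: N => [|N ih]; first by rewrite big_ord0 mulr0 mul0r sub0r cosN subrr.
rewrite big_ord_recr/= mulrDr ih.
rewrite (_ : N.+1%:R * t - t / 2 = N%:R * t + t / 2); last by rewrite -natr1; field.
rewrite cosB cosD; ring.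
Qed.

(** The telescoped sums are at most 2 in absolute value, so sin(t/2) times either sum is at most 1;
    the two squares add up to at most 2. *)
Lemma fejer_le N t : sin (t / 2) ^+ 2 * fejer N t <= 2.
Proof.
have sq (a b : R) : `|a| <= 2 -> 2 * b = a -> b ^+ 2 <= 1.
  by rewrite ler_norml => /andP[h1 h2] h; nra.
have h1 : (sin (t / 2) * \sum_(i < N) cos (i%:R * t)) ^+ 2 <= 1.
  apply: (sq _ _ _ (etrans (mulrA _ _ _) (sum_cos_half N t))).
  by apply: le_trans (ler_normD _ _) _; rewrite -[leRHS]/(1 + 1) lerD ?sin_max.
have h2 : (sin (t / 2) * \sum_(i < N) sin (i%:R * t)) ^+ 2 <= 1.
  apply: (sq _ _ _ (etrans (mulrA _ _ _) (sum_sin_half N t))).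
  by apply: le_trans (ler_normB _ _) _; rewrite -[leRHS]/(1 + 1) lerD ?cos_max.
rewrite fejerE mulrDr -!exprMn; exact: lerD h1 h2.
Qed.

Lemma fejer_ge0 N t : 0 <= fejer N t.
Proof. by rewrite fejerE addr_ge0 ?sqr_ge0. Qed.

Lemma cvg_fejer0 t : sin (t / 2) != 0 ->
  fejer N t / N%:R ^+ 2 @[N --> \oo] --> 0.
Proof.
move=> s0; have s2 : 0 < sin (t / 2) ^+ 2 by rewrite exprn_even_gt0.
apply: (@squeeze_cvgr _ _ _ _ (cst 0) (fun N => 2 / sin (t / 2) ^+ 2 * N%:R^-1)).
- near=> N; rewrite divr_ge0 ?fejer_ge0 ?exprn_ge0//=.
  have N0 : (0 : R) < N%:R by rewrite ltr0n; near: N; exists 1%N.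
  have N1 : (1 : R) <= N%:R by rewrite -[1]/(1%:R) ler_nat -(ltr0n R).
  apply: ler_pM; rewrite ?fejer_ge0 ?invr_ge0 ?exprn_ge0//.
    by rewrite ler_pdivlMr// mulrC fejer_le.
  rewrite lef_pV2 ?posrE ?exprn_gt0//.
  by rewrite expr2 ler_peMl// ltW.
- exact: cvg_cst.
- rewrite -[X in _ --> X](mulr0 (2 / sin (t / 2) ^+ 2)).
  apply: cvgM; first exact: cvg_cst.
  apply/gtr0_cvgV0; first by exists 1%N => // n /= n1; rewrite ltr0n.
  exact: cvgr_idn.
Unshelve. all: by end_near.
Qed.

End fejer.

Section wiener.
Context d (T : measurableType d) (R : realType).
Variable mu : {finite_measure set T -> \bar R}.
Variables (u w : T -> R) (B : R).
Hypothesis mu_u : measurable_fun setT u.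
Hypothesis mw : measurable_fun setT w.
Hypothesis wB : forall x, `|w x| <= B.
Hypothesis u0 : forall c, mu (u @^-1` [set c]) = 0%E.

(** The cosine transform of the image under u of the measure w . mu; by [u0] this image has no
    atoms. *)
Definition cos_coef (s : R) := \int[mu]_x (cos (s * u x) * w x).

Let mcos (f : T -> R) : measurable_fun setT f -> measurable_fun setT (fun x => cos (f x)).
Proof.
move=> mf; apply: measurableT_comp => //.
by apply: continuous_measurable_fun; exact: continuous_cos.
Qed.

Let mcosw s : measurable_fun setT (fun x => cos (s * u x) * w x).
Proof. by apply: measurable_funM => //; apply: mcos; exact: measurable_funM. Qed.

Let cosw_le s x : `|cos (s * u x) * w x| <= B.
Proof.
rewrite normrM; apply: le_trans (wB x).
by rewrite ler_piMl// cos_max.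
Qed.

Let integrable_cosw s : mu.-integrable setT (EFin \o (fun x => cos (s * u x) * w x)).
Proof. exact: finite_bounded_integrable (mcosw s) (cosw_le s). Qed.

Lemma cos_coef_le s : `|cos_coef s| <= B * fine (mu setT).
Proof.
apply: le_trans (le_normr_Rintegral measurableT (integrable_cosw s)) _.
rewrite -Rintegral_cst//; apply: le_Rintegral => //.
- by have := integrable_abse (integrable_cosw s); apply: eq_integrable.
- by apply: (@finite_bounded_integrable _ _ _ _ (cst B) `|B|).
Qed.

(** The exceptional set is covered by countably many level sets of u, all null by [u0]. As e^2 = 1,
    multiplying by e solves for u x. *)
Lemma ae_sin_half_neq0 (e a : R) : `|e| = 1 ->
  {ae mu, forall x, sin ((a + e * u x) / 2) != 0}.
Proof.
move=> e1; have e2 : e * e = 1 by rewrite -expr2 -[e ^+ 2]real_normK ?num_real// e1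
  expr1n.
pose A (k : int) := u @^-1` [set e * (2 * k%:~R * pi - a)].
have mA k : measurable (A k).
  by rewrite -[A k]setTI; exact: mu_u.
have NE : [set x | sin ((a + e * u x) / 2) = 0] `<=` \bigcup_k A k.
  move=> x /= /sin_eq0_int[k hk]; exists k => //=; rewrite /A /=.
  have -> : 2 * k%:~R * pi = a + e * u x.
    by rewrite -mulrA -hk mulrC divfK.
  by rewrite addrC addKr mulrA e2 mul1r.
have : mu.-negligible (\bigcup_k A k).
  (* The union over the integers is reindexed by the naturals. *)
  pose A' n := if @unpickle int n is Some k then A k else set0.
  have -> : \bigcup_k A k = \bigcup_n A' n.
    apply/seteqP; split => x [k _ Ak].
      by exists (pickle k) => //; rewrite /A' pickleK.
    by move: Ak; rewrite /A'; case: unpickle => // k' ?; exists k'.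
  apply: negligible_bigcup => n; rewrite /A'; case: unpickle => [k|];
    last exact: negligible_set0.
  by apply/negligibleP; [exact: mA|exact: u0].
apply: negligibleS => x /= /negP; rewrite negbK => /eqP h; exact: NE.
Qed.

Lemma fejer_coscos N (a b : R) :
  \sum_(i < N) \sum_(j < N) cos ((i%:R - j%:R) * a) * cos ((i%:R - j%:R) * b) =
  (fejer N (a + -1 * b) + fejer N (a + 1 * b)) / 2.
Proof.
rewrite /fejer -big_split mulr_suml; apply: eq_bigr => i _.
rewrite -big_split mulr_suml; apply: eq_bigr => j _ /=.
rewrite mulN1r mul1r !mulrDr mulrN cosB cosD; by field.
Qed.

(** The mean of Wiener's lemma with one factor of each square replaced by the cosine at a.
    Integrating [avg N (u x) * w x] restores the squares. *)
Let avg N a := (\sum_(i < N) \sum_(j < N) cos_coef (i%:R - j%:R) * cos ((i%:R -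
  j%:R) * a)) / N%:R ^+ 2.

Let mean2_le N (f : 'I_N -> 'I_N -> R) M : 0 <= M -> (forall i j, `|f i j| <= M) ->
  `|(\sum_(i < N) \sum_(j < N) f i j) / N%:R ^+ 2| <= M.
Proof.
move=> M0 fM; rewrite normrM normfV [X in _ / X]ger0_norm ?exprn_ge0//.
have [N0|N0] := posnP N; first by subst N; rewrite expr0n/= invr0 mulr0.
rewrite ler_pdivrMr ?exprn_gt0 ?ltr0n//.
apply: le_trans (ler_norm_sum _ _ _) _.
have -> : M * N%:R ^+ 2 = \sum_(i < N) \sum_(j < N) M.
  have h (x : R) : \sum_(i < N) x = x * N%:R by rewrite sumr_const card_ord mulr_natr.
  by rewrite (eq_bigr (fun=> M * N%:R)) => [|i _]; rewrite h// expr2 mulrA.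
by apply: ler_sum => i _; apply: le_trans (ler_norm_sum _ _ _) _; apply: ler_sum.
Qed.

Let avgE N a : avg N a =
  \int[mu]_x (((fejer N (a + -1 * u x) + fejer N (a + 1 * u x)) / 2) / N%:R ^+ 2 * w x).
Proof.
pose g i j x := cos ((i%:R - j%:R) * u x) * w x * (cos ((i%:R - j%:R) * a) / N%:R ^+ 2).
have ig i j : mu.-integrable setT (EFin \o g i j).
  rewrite (_ : _ \o _ = (fun x => (cos ((i%:R - j%:R) * u x) * w x)%:E * (cos ((i%:R
    - j%:R) * a) / N%:R ^+ 2)%:E)%E)//.
  by apply: integrableZr; [exact: measurableT|exact: integrable_cosw].
have [_ E1] := @Rintegral_sum _ _ _ mu _ (index_enum 'I_N) (fun i x => \sum_(j < N)
  g i j x)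
   (fun i => (@Rintegral_sum _ _ _ mu _ (index_enum 'I_N) (fun j x => g i j x) (ig i)).1).
transitivity (\int[mu]_x (\sum_(i < N) \sum_(j < N) g i j x)).
  rewrite E1 /avg mulr_suml; apply: eq_bigr => i _.
  have [_ ->] := @Rintegral_sum _ _ _ mu _ (index_enum 'I_N) (fun j x => g i j x) (ig i).
  rewrite mulr_suml; apply: eq_bigr => j _.
  by rewrite RintegralZr// -mulrA.
apply: eq_Rintegral => x _; rewrite -fejer_coscos !mulr_suml; apply: eq_bigr => i _.
by rewrite !mulr_suml; apply: eq_bigr => j _; rewrite /g; ring.
Qed.

Let mfejer N (f : T -> R) : measurable_fun setT f -> measurable_fun setT (fun x =>
  fejer N (f x)).
Proof.
move=> mf; apply: measurable_sum => i; apply: measurable_sum => j.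
by apply: mcos; exact: measurable_funM.
Qed.

(** The product of two cosines turns [avg] into an integral of Fejér kernels at a - u and a + u,
    hence the two signs below. After division by N^2 the integrand is bounded by B and tends to 0
    almost everywhere. *)
Let cvg_avg0 a : avg N a @[N --> \oo] --> 0.
Proof.
under eq_fun do rewrite avgE.
apply: (@cvg_Rintegral_bounded0 _ _ _ mu _ B).
- move=> N; apply: measurable_funM => //; apply: measurable_funM => //;
  apply: measurable_funM => //.
  apply: measurable_funD; apply: mfejer; apply: measurable_funD => //;
    exact: measurable_funM.
- move=> N x; rewrite normrM; apply: le_trans (wB x); rewrite ler_piMl//.
  rewrite -fejer_coscos; apply: mean2_le => // i j; rewrite normrM.
  by rewrite mulr_ile1// cos_max.
- have h1 := @ae_sin_half_neq0 (-1) a (normrN1 R).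
  have h2 := @ae_sin_half_neq0 1 a (normr1 R).
  apply: filterS2 h1 h2 => x s1 s2.
  have : ((fejer N (a + -1 * u x) / N%:R ^+ 2 + fejer N (a + 1 * u x) / N%:R ^+ 2) *
    (2^-1 * w x))
      @[N --> \oo] --> (0 + 0) * (2^-1 * w x).
    by apply: cvgM; [apply: cvgD; exact: cvg_fejer0|exact: cvg_cst].
  rewrite addr0 mul0r; apply: cvg_trans; apply: near_eq_cvg; apply: nearW => N /=.
  by rewrite /=; ring.
Qed.

(* Wiener's lemma. One of the two factors of each square is kept as a number
   while the other is an integral, so that two successive passages to the limit
   under a single integral replace Fubini's theorem on [mu \x mu]. *)
Lemma cvg_cos_coef_sqr_mean :
  (\sum_(i < N) \sum_(j < N) cos_coef (i%:R - j%:R) ^+ 2) / N%:R ^+ 2 @[N --> \oo] --> 0.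
Proof.
set M := B * fine (mu setT).
have M0 : 0 <= M by apply: le_trans (cos_coef_le 0); exact: normr_ge0.
have E N : (\sum_(i < N) \sum_(j < N) cos_coef (i%:R - j%:R) ^+ 2) / N%:R ^+ 2 =
   \int[mu]_x (avg N (u x) * w x).
  pose g i j x := cos ((i%:R - j%:R) * u x) * w x * (cos_coef (i%:R - j%:R) / N%:R ^+ 2).
  have ig i j : mu.-integrable setT (EFin \o g i j).
    rewrite (_ : _ \o _ = (fun x => (cos ((i%:R - j%:R) * u x) * w x)%:E * (cos_coef
      (i%:R - j%:R) / N%:R ^+ 2)%:E)%E)//.
    by apply: integrableZr; [exact: measurableT|exact: integrable_cosw].
  have [_ E1] := @Rintegral_sum _ _ _ mu _ (index_enum 'I_N) (fun i x => \sum_(j <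
    N) g i j x)
     (fun i => (@Rintegral_sum _ _ _ mu _ (index_enum 'I_N) (fun j x => g i j x) (ig
       i)).1).
  transitivity (\int[mu]_x (\sum_(i < N) \sum_(j < N) g i j x)).
    rewrite E1 mulr_suml; apply: eq_bigr => i _.
    have [_ ->] := @Rintegral_sum _ _ _ mu _ (index_enum 'I_N) (fun j x => g i j x)
      (ig i).
    rewrite mulr_suml; apply: eq_bigr => j _.
    by rewrite RintegralZr// expr2 -mulrA.
  apply: eq_Rintegral => x _; rewrite /avg !mulr_suml; apply: eq_bigr => i _.
  by rewrite !mulr_suml; apply: eq_bigr => j _; rewrite /g; ring.
under eq_fun do rewrite E.
apply: (@cvg_Rintegral_bounded0 _ _ _ mu _ (M * B)).
- move=> N; apply: measurable_funM => //; apply: measurable_funM => //.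
  apply: measurable_sum => i; apply: measurable_sum => j.
  by apply: measurable_funM => //; apply: mcos; exact: measurable_funM.
- move=> N x; rewrite normrM ler_pM//.
  apply: mean2_le => // i j; rewrite normrM -[M]mulr1 ler_pM ?cos_max ?cos_coef_le//.
- apply: aeW => x.
  rewrite -[X in _ --> X](mul0r (w x)).
  by apply: cvgM; [exact: cvg_avg0|exact: cvg_cst].
Qed.

End wiener.

(** * Fourth moments of a Gaussian field *)

Section real_integrable.
Context d (T : measurableType d) (R : realType) (mu : {measure set T -> \bar R}).

Definition rintegrable (f : T -> R) := mu.-integrable setT (EFin \o f).

Lemma rintegrableD f g : rintegrable f -> rintegrable g -> rintegrable (fun x => f x
  + g x).
Proof.
move=> fi gi; rewrite /rintegrable (_ : _ \o _ = ((EFin \o f) \+ (EFin \o g))%E)//.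
by apply: integrableD; [exact: measurableT|exact: fi|exact: gi].
Qed.

Lemma rintegrableZ c f : rintegrable f -> rintegrable (fun x => c * f x).
Proof.
move=> fi; rewrite /rintegrable (_ : _ \o _ = (fun x => c%:E * (EFin \o f) x)%E)//.
by apply: integrableZl; [exact: measurableT|exact: fi].
Qed.

Lemma rintegrableB f g : rintegrable f -> rintegrable g -> rintegrable (fun x => f x
  - g x).
Proof.
move=> fi gi; rewrite (_ : (fun _ => _) = (fun x => f x + (-1) * g x)).
  by apply: rintegrableD => //; exact: rintegrableZ.
by apply/funext => x; rewrite mulN1r.
Qed.

End real_integrable.

Section gaussian_space.
Context d (T : measurableType d) (R : realType) (P : probability T R).
(** [G] stands for the finite linear combinations of the field. Joint moments of two elements are
    reached by polarization from moments of single ones. *)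
Variable G : set (T -> R).
Hypothesis GD : forall U V, G U -> G V -> G (fun w => U w + V w).
Hypothesis GB : forall U V, G U -> G V -> G (fun w => U w - V w).
Hypothesis Gint : forall U k, G U -> rintegrable P (fun w => U w ^+ k).
Hypothesis G4 : forall U, G U -> \int[P]_w (U w ^+ 4) = 3 * (\int[P]_w (U w ^+ 2)) ^+ 2.

Let rcst (c : R) : rintegrable P (fun=> c).
Proof. exact: finite_measure_integrable_cst. Qed.

Lemma gaussian_rintegrableM U V : G U -> G V -> rintegrable P (fun w => U w * V w).
Proof.
move=> GU GV; rewrite (_ : (fun _ => _) =
  (fun w => 4^-1 * ((U w + V w) ^+ 2 - (U w - V w) ^+ 2))).
  by apply/rintegrableZ/rintegrableB; apply: (Gint 2); [exact: GD|exact: GB].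
by apply/funext => w; field.
Qed.

Lemma gaussian_rintegrableM2 U V : G U -> G V ->
  rintegrable P (fun w => U w ^+ 2 * V w ^+ 2).
Proof.
move=> GU GV; rewrite (_ : (fun _ => _) =
  (fun w => 12^-1 * (((U w + V w) ^+ 4 + (U w - V w) ^+ 4) - 2 * (U w ^+ 4 + V w ^+ 4)))).
  apply/rintegrableZ/rintegrableB.
    by apply: rintegrableD; apply: (Gint 4); [exact: GD|exact: GB].
  by apply: rintegrableZ; apply: rintegrableD; exact: (Gint 4).
by apply/funext => w; field.
Qed.

(* Isserlis' formula, by polarization:
   [12 U^2 V^2 = (U + V)^4 + (U - V)^4 - 2 U^4 - 2 V^4]. *)
Lemma gaussian_moment22 U V : G U -> G V ->
  \int[P]_w (U w ^+ 2 * V w ^+ 2) =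
  \int[P]_w (U w ^+ 2) * \int[P]_w (V w ^+ 2) + 2 * (\int[P]_w (U w * V w)) ^+ 2.
Proof.
move=> GU GV.
have i2 W : G W -> rintegrable P (fun w => W w ^+ 2) by exact: Gint.
have i4 W : G W -> rintegrable P (fun w => W w ^+ 4) by exact: Gint.
have iM := gaussian_rintegrableM GU GV.
have iM2 := rintegrableZ 2 iM.
have ED : \int[P]_w ((U w + V w) ^+ 2) =
  \int[P]_w (U w ^+ 2) + \int[P]_w (V w ^+ 2) + 2 * \int[P]_w (U w * V w).
  rewrite -RintegralZl// -RintegralD//; [|exact: i2|exact: i2].
  rewrite -RintegralD//; last by apply: rintegrableD; exact: i2.
  by apply: eq_Rintegral => w _; ring.
have EB : \int[P]_w ((U w - V w) ^+ 2) =
  \int[P]_w (U w ^+ 2) + \int[P]_w (V w ^+ 2) - 2 * \int[P]_w (U w * V w).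
  rewrite -RintegralZl// -RintegralD//; [|exact: i2|exact: i2].
  rewrite -RintegralB//; last by apply: rintegrableD; exact: i2.
  by apply: eq_Rintegral => w _; ring.
have E4 : \int[P]_w ((U w + V w) ^+ 4) + \int[P]_w ((U w - V w) ^+ 4) =
  2 * (\int[P]_w (U w ^+ 4) + \int[P]_w (V w ^+ 4)) + 12 * \int[P]_w (U w ^+ 2 * V w
    ^+ 2).
  have iM22 := gaussian_rintegrableM2 GU GV.
  rewrite -RintegralD//; [|exact: (i4 _ (GD GU GV))|exact: (i4 _ (GB GU GV))].
  rewrite -[X in 2 * X]RintegralD//; [|exact: i4|exact: i4].
  have i44 := rintegrableD (i4 _ GU) (i4 _ GV).
  rewrite -!RintegralZl// -RintegralD//; [|exact: rintegrableZ|exact: rintegrableZ].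
  by apply: eq_Rintegral => w _; ring.
move: E4; rewrite (G4 (GD GU GV)) (G4 (GB GU GV)) (G4 GU) (G4 GV) ED EB.
set A := \int[P]_w (U w ^+ 2); set B := \int[P]_w (V w ^+ 2).
set C := \int[P]_w (U w * V w); set D := \int[P]_w (_ * _) => E4.
lra.
Qed.

(** The square is a double sum of products (U_i^2 - rho)(U_j^2 - rho), evaluated by Isserlis'
    formula. The number rho need not be the variance of the U_i: points moved into D have slightly
    different variances, recorded in the terms a i i - rho. *)
Lemma gaussian_quadratic_mean N (U : 'I_N -> T -> R) (rho : R) : (0 < N)%N ->
  (forall i, G (U i)) ->
  let a i j := \int[P]_w (U i w * U j w) in
  rintegrable P (fun w => ((\sum_(i < N) U i w ^+ 2) / N%:R - rho) ^+ 2) /\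
  \int[P]_w (((\sum_(i < N) U i w ^+ 2) / N%:R - rho) ^+ 2) =
  (\sum_(i < N) \sum_(j < N) ((a i i - rho) * (a j j - rho) + 2 * a i j ^+ 2)) /
    N%:R ^+ 2.
Proof.
move=> N0 GU a.
have Nn0 : N%:R != 0 :> R by rewrite pnatr_eq0 -lt0n.
pose g i j w : R := (U i w ^+ 2 * U j w ^+ 2 - rho * (U i w ^+ 2 + U j w ^+ 2)) +
  rho ^+ 2.
have i2 i : rintegrable P (fun w => U i w ^+ 2) by exact: Gint.
have i2D i j := rintegrableD (i2 i) (i2 j).
have i22 i j := gaussian_rintegrableM2 (GU i) (GU j).
have ig0 i j := rintegrableB (i22 i j) (rintegrableZ rho (i2D i j)).
have ig i j : rintegrable P (g i j) by apply: rintegrableD (ig0 i j) (rcst _).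
have aE i : \int[P]_w (U i w ^+ 2) = a i i by apply: eq_Rintegral => w _.
have gE i j : \int[P]_w (g i j w) = (a i i - rho) * (a j j - rho) + 2 * a i j ^+ 2.
  rewrite RintegralD//; [|exact: ig0|exact: rcst].
  rewrite RintegralB//; [|exact: i22|exact: rintegrableZ].
  rewrite (@RintegralZl _ _ _ P setT _ rho measurableT (i2D i j)) RintegralD//;
    [|exact: i2|exact: i2].
  rewrite gaussian_moment22// !aE Rintegral_cst// [X in fine X]probability_setT /=.
  by rewrite -/(a i j); ring.
have S i := @Rintegral_sum _ _ _ P _ (index_enum 'I_N) (fun j => g i j) (ig i).
have [iSS SS] := @Rintegral_sum _ _ _ P _ (index_enum 'I_N)
  (fun i w => \sum_(j < N) g i j w) (fun i => (S i).1).
have fE : (fun w => ((\sum_(i < N) U i w ^+ 2) / N%:R - rho) ^+ 2) =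
  (fun w => N%:R ^- 2 * \sum_(i < N) \sum_(j < N) g i j w).
  apply/funext => w; set Q := \sum_(i < N) U i w ^+ 2.
  have -> : \sum_(i < N) \sum_(j < N) g i j w = (Q - N%:R * rho) ^+ 2.
    have cs (x : R) : \sum_(j < N) x = N%:R * x by rewrite sumr_const card_ord mulr_natl.
    have -> : Q - N%:R * rho = \sum_(i < N) (U i w ^+ 2 - rho) by rewrite sumrB cs.
    rewrite expr2 mulr_suml; apply: eq_bigr => i _.
    by rewrite mulr_sumr; apply: eq_bigr => j _; rewrite /g; ring.
  by field.
rewrite fE; split; first exact: rintegrableZ.
rewrite RintegralZl// SS mulrC; congr (_ / _).
by apply: eq_bigr => i _; rewrite (S i).2; apply: eq_bigr => j _; exact: gE.
Qed.

End gaussian_space.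

(** * Linear combinations of values of the field *)

Section field.
Context (R : realType) (d : nat) (disp : measure_display) (Omega : measurableType disp).
Variables (xi : {mfun Omega >-> field_space R d}) (P : probability Omega R).

Lemma measurable_field x : measurable_fun setT (fun w => xi w x).
Proof.
move=> _ A mA; rewrite setTI.
pose B : set 'rV[R]_1 := (fun v : 'rV[R]_1 => v ord0 ord0) @^-1` A.
have mB : measurable B by rewrite -[B]setTI; exact: measurable_coord.
pose C : set (field_space R d) := [set s | B (eval_at (fun _ : 'I_1 => x) s)].
have mC : measurable C.
  by apply: sub_sigma_algebra; exists 0%N, (fun _ : 'I_1 => x), B; split.
rewrite (_ : _ @^-1` A = xi @^-1` C).
  by rewrite -[X in measurable X]setTI; exact: measurable_funPT.
by apply/seteqP; split => w; rewrite /C /B /= mxE.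
Qed.

Hypothesis gauss : gaussian_field P xi.
Hypothesis mean0 : mean_zero P xi.

Definition lincomb (s : seq (R * 'rV[R]_d)) (w : Omega) : R :=
  \sum_(p <- s) p.1 * xi w p.2.

(** Lists are nonempty because [gaussian_field] speaks of vectors indexed by ['I_n.+1]. Points may
    repeat, so sums and differences are concatenations. *)
Definition lincombs : set (Omega -> R) :=
  [set L | exists p s, L = lincomb (p :: s)].

Lemma measurable_lincomb s : measurable_fun setT (lincomb s).
Proof.
by apply: measurable_sum => p; apply: measurable_funM => //; exact: measurable_field.
Qed.

Lemma gaussian_law_lincomb p s : gaussian_law (pushforward P (lincomb (p :: s))).
Proof.
have := gauss (fun i : 'I_(size s).+1 => (nth p (p :: s) i).2) (\row_i (nth p (p ::
  s) i).1).
congr (gaussian_law (pushforward _ _)); apply/funext => w.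
rewrite /lincomb (big_nth p) big_mkord /dot.
by apply: eq_bigr => i _; rewrite !mxE.
Qed.

Lemma integrable_field x : rintegrable P (fun w => xi w x).
Proof.
rewrite (_ : (fun _ => _) = lincomb [:: (1, x)]).
  by apply: gaussian_law_integrable; [exact: measurable_lincomb|exact:
    gaussian_law_lincomb].
by apply/funext => w; rewrite /lincomb big_seq1 mul1r.
Qed.

Lemma Rintegral_field x : \int[P]_w xi w x = 0.
Proof. by have := mean0 x; rewrite unlock => /(congr1 fine). Qed.

Lemma Rintegral_lincomb s : \int[P]_w lincomb s w = 0.
Proof.
have h := @Rintegral_sum _ _ _ P _ s (fun p w => p.1 * xi w p.2)
  (fun p => rintegrableZ p.1 (integrable_field p.2)).
rewrite h.2 big1// => p _; rewrite RintegralZl//; last exact: integrable_field.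
by rewrite Rintegral_field mulr0.
Qed.

Lemma lincombsD U V : lincombs U -> lincombs V -> lincombs (fun w => U w + V w).
Proof.
move=> [p [s ->]] [q [t ->]]; exists p, (s ++ q :: t); apply/funext => w.
by rewrite /lincomb -cat_cons big_cat.
Qed.

Lemma lincombsB U V : lincombs U -> lincombs V -> lincombs (fun w => U w - V w).
Proof.
move=> [p [s ->]] [q [t ->]].
exists p, (s ++ [seq (- r.1, r.2) | r <- q :: t]); apply/funext => w.
rewrite /lincomb -cat_cons big_cat /= -[in RHS]/(map (fun r => (- r.1,
  r.2)) (q :: t)) big_map -sumrN.
by congr (_ + _); apply: eq_bigr => r _; rewrite mulNr.
Qed.

Lemma lincombs_integrable U k : lincombs U -> rintegrable P (fun w => U w ^+ k).
Proof.
move=> [p [s ->]]; apply: gaussian_law_integrable_exprn.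
- exact: measurable_lincomb.
- exact: gaussian_law_lincomb.
- exact: Rintegral_lincomb.
Qed.

Lemma lincombs_moment4 U : lincombs U ->
  \int[P]_w (U w ^+ 4) = 3 * (\int[P]_w (U w ^+ 2)) ^+ 2.
Proof.
move=> [p [s ->]]; apply: gaussian_law_moment4.
- exact: measurable_lincomb.
- exact: gaussian_law_lincomb.
- exact: Rintegral_lincomb.
Qed.

Lemma lincombs_field x : lincombs (fun w => xi w x).
Proof.
exists (1, x), [::]; apply/funext => w; by rewrite /lincomb big_seq1 mul1r.
Qed.

Lemma cov_funE x y : cov_fun P xi x y = \int[P]_w (xi w x * xi w y).
Proof. by rewrite /cov_fun unlock. Qed.

Lemma cov_pair x y x' y' :
  \int[P]_w ((xi w x + xi w y) * (xi w x' + xi w y')) =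
  cov_fun P xi x x' + cov_fun P xi x y' + cov_fun P xi y x' + cov_fun P xi y y'.
Proof.
have i u v : rintegrable P (fun w => xi w u * xi w v).
  by apply: (gaussian_rintegrableM lincombsD lincombsB lincombs_integrable);
     exact: lincombs_field.
rewrite !cov_funE -RintegralD//; [|exact: i|exact: i].
rewrite -RintegralD//; [|by apply: rintegrableD; exact: i|exact: i].
rewrite -RintegralD//; [|by do 2 (apply: rintegrableD; last exact: i); exact: i|exact: i].
by apply: eq_Rintegral => w _; ring.
Qed.

End field.

(** * The spectral side *)

Lemma cons_rV0 (R : realType) n (x : R) (v : 'rV[R]_n) : cons_rV (x, v) ord0 ord0 = x.
Proof.
rewrite -[RHS]/((x, v).1) -[in RHS](cons_rVK (x, v)) /=.
by congr (cons_rV _ _ _); exact/val_inj.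
Qed.

(** The hyperplane is the product of a null singleton with the whole space, and 0 times infinity is
    0. *)
Lemma lebesgue_rV_hyperplane (R : realType) n (c : R) :
  lebesgue_rV R n.+1 [set v | v ord0 ord0 = c] = 0%E.
Proof.
rewrite /= /cons_measure /pushforward (_ : _ @^-1` _ = [set c] `*` setT).
  by rewrite product_measure1E//= lebesgue_measure_set1 mul0e.
by apply/seteqP; split => -[x v] /=; rewrite cons_rV0 => // -[].
Qed.

Section spectral.
Context (R : realType) (n : nat) (F : {finite_measure set 'rV[R]_n -> \bar R}).

Lemma measurable_dot (h : 'rV[R]_n) : measurable_fun setT (fun l : 'rV[R]_n => dot l h).
Proof.
apply: measurable_sum => i; apply: measurable_funM => //; exact: measurable_coord.
Qed.

Lemma measurable_cos_dot (h : 'rV[R]_n) (g : R -> R) : measurable_fun setT g ->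
  measurable_fun setT (fun l : 'rV[R]_n => cos (g (dot l h))).
Proof.
move=> mg; apply: measurableT_comp.
  by apply: continuous_measurable_fun; exact: continuous_cos.
by apply: measurableT_comp => //; exact: measurable_dot.
Qed.

Lemma dotDr (l x y : 'rV[R]_n) : dot l (x + y) = dot l x + dot l y.
Proof. by rewrite /dot -big_split; apply: eq_bigr => i _; rewrite mxE mulrDr. Qed.

Lemma dotNr (l x : 'rV[R]_n) : dot l (- x) = - dot l x.
Proof. by rewrite /dot -sumrN; apply: eq_bigr => i _; rewrite mxE mulrN. Qed.

Lemma dotZr (l x : 'rV[R]_n) a : dot l (a *: x) = a * dot l x.
Proof. by rewrite /dot mulr_sumr; apply: eq_bigr => i _; rewrite mxE mulrCA. Qed.

Lemma spectral_cos (c : 'rV[R]_n -> 'rV[R]_n -> R) : spectral_representation F c ->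
  forall x y, c x y = \int[F]_l cos (dot l (x - y)).
Proof. by move=> Fc x y; have /(congr1 (@complex.Re R)) := Fc x y. Qed.

Lemma rintegrable_cos_dot z : rintegrable F (fun l => cos (dot l z)).
Proof.
apply: (@finite_bounded_integrable _ _ _ _ _ 1).
  exact: (@measurable_cos_dot z id).
by move=> l; exact: cos_max.
Qed.

End spectral.

Section ideal.
Context (R : realType) (n : nat) (F : {finite_measure set 'rV[R]_n.+1 -> \bar R}).
Variable c : 'rV[R]_n.+1 -> 'rV[R]_n.+1 -> R.
Hypothesis Fc : spectral_representation F c.
Hypothesis Fac : F `<< lebesgue_rV R n.+1.
Variable h : 'rV[R]_n.+1.

Definition pair_cov (x y x' y' : 'rV[R]_n.+1) := c x x' + c x y' + c y x' + c y y'.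

(* Covariance of [U_i] and [U_j], where [U_i = xi (i e) + xi (i e + h)] and [e]
   is the first basis vector. *)
Definition lattice_cov (i j : nat) :=
  let e : 'rV[R]_n.+1 := delta_mx ord0 ord0 in
  pair_cov (i%:R *: e) (i%:R *: e + h) (j%:R *: e) (j%:R *: e + h).

(* [w l = |1 + expi (dot l h)|^2]: the sequence [U_i] is stationary with spectral
   measure [w . F]. *)
Let w (l : 'rV[R]_n.+1) : R := 2 + 2 * cos (dot l h).

Lemma dot_delta_mx (l : 'rV[R]_n.+1) : dot l (delta_mx ord0 ord0) = l ord0 ord0.
Proof.
rewrite /dot (bigD1 ord0)//= mxE !eqxx mulr1 big1 ?addr0// => i i0.
by rewrite mxE eqxx (negbTE i0) mulr0.
Qed.

(** With t = (i - j) l_0 and s = dot l h, the four cosines add up to 2 cos t + cos(t - s) + cos(t +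
    s) = cos t (2 + 2 cos s). *)
Lemma lattice_covE i j :
  lattice_cov i j = cos_coef F (fun l => l ord0 ord0) w (i%:R - j%:R).
Proof.
rewrite /lattice_cov /pair_cov !(spectral_cos Fc) /cos_coef.
have ic := rintegrable_cos_dot F.
rewrite -RintegralD//; [|exact: ic|exact: ic].
rewrite -RintegralD//; [|by apply: rintegrableD; exact: ic|exact: ic].
rewrite -RintegralD//; [|by do 2 (apply: rintegrableD; last exact: ic);
  exact: ic|exact: ic].
apply: eq_Rintegral => l _; rewrite !dotDr !dotNr !dotDr !dotZr !dot_delta_mx /w.
set t := (i%:R - j%:R) * l ord0 ord0.
have -> : i%:R * l ord0 ord0 - j%:R * l ord0 ord0 = t by rewrite /t; ring.
have -> : i%:R * l ord0 ord0 - (j%:R * l ord0 ord0 + dot l h) = t - dot l h by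
  rewrite /t; ring.
have -> : i%:R * l ord0 ord0 + dot l h - j%:R * l ord0 ord0 = t + dot l h by rewrite
  /t; ring.
have -> : i%:R * l ord0 ord0 + dot l h - (j%:R * l ord0 ord0 + dot l h) = t by
  rewrite /t; ring.
rewrite cosB cosD; ring.
Qed.

(** Wiener's lemma for the first coordinate: its level sets are hyperplanes, which F does not charge
    by absolute continuity. *)
Lemma cvg_lattice_cov_sqr_mean :
  (\sum_(i < N) \sum_(j < N) lattice_cov i j ^+ 2) / N%:R ^+ 2 @[N --> \oo] --> 0.
Proof.
under eq_fun do under eq_bigr do under eq_bigr do rewrite lattice_covE.
apply: (@cvg_cos_coef_sqr_mean _ _ _ F _ _ 4).
- exact: measurable_coord.
- apply: measurable_funD => //; apply: measurable_funM => //.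
  exact: (@measurable_cos_dot _ _ h id).
- move=> l; rewrite /w ler_norml; have := cos_le1 (dot l h); have :=
  cos_geN1 (dot l h); lra.
- move=> x; apply: (null_content_dominatesP _ _).1 Fac _ _ _.
    by rewrite -[X in measurable X]setTI; exact: measurable_coord.
  exact: lebesgue_rV_hyperplane.
Qed.

End ideal.

Section separation.
Context (R : realType) (n : nat).
Variables (F1 F2 : {finite_measure set 'rV[R]_n -> \bar R}).

(** Equal covariances would have equal spectral measures by uniqueness. The densities, integrable
    because these measures are finite, would then agree almost everywhere. *)
Lemma spectral_density_neq (c1 c2 : 'rV[R]_n -> 'rV[R]_n -> R) (f1 f2 : 'rV[R]_n -> R) :
  spectral_measure F1 c1 -> spectral_measure F2 c2 ->
  spectral_density F1 f1 -> spectral_density F2 f2 ->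
  (0 < lebesgue_rV R n [set l | f1 l <> f2 l])%E -> c1 <> c2.
Proof.
move=> [r1 _] [_ u2] [m1 f10 d1] [m2 f20 d2] + cE.
have FE A : measurable A -> F1 A = F2 A by apply: u2; rewrite -cE.
have i1 : (lebesgue_rV R n).-integrable setT (EFin \o f1).
  apply/integrableP; split; first exact/measurable_EFinP.
  have F1T : F1 setT \is a fin_num by exact: fin_num_measure.
  move: F1T; rewrite d1// ge0_fin_numE; last first.
    by apply: integral_ge0 => x _; rewrite lee_fin.
  by under [X in (_ -> X < _)%E]eq_integral do rewrite /= ger0_norm//.
have ae : ae_eq (lebesgue_rV R n) setT (EFin \o f1) (EFin \o f2).
  apply: integral_ae_eq => //; first exact/measurable_EFinP.
  by move=> E _ mE; rewrite -d1// -d2// FE.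
rewrite (_ : lebesgue_rV R n _ = 0%E) ?ltxx//.
have mN : measurable [set l | f1 l <> f2 l].
  rewrite (_ : [set _ | _] = setT `&` [set l | (EFin \o f1) l != (EFin \o f2) l]).
    by apply: measurable_neqe => //; exact/measurable_EFinP.
  by apply/seteqP; split => [l fl|l [_ /eqP fl]]; [split => //;
    apply/eqP => -[]|move=> fE; apply: fl; rewrite /= fE].
apply/negligibleP => //.
apply: negligibleS ae => l /= fl /(_ Logic.I) [].
exact: fl.
Qed.

End separation.

(** * Separation of the two measures *)

Section sigma_field.
Context (R : realType) (d : nat) (disp : measure_display) (Omega : measurableType disp).
Variables (xi : {mfun Omega >-> field_space R d}).

(** The statistic T_N, with i e and i e + h replaced by arbitrary points X i and Y i, later taken in
    D. *)
Definition mean_square N (X Y : nat -> 'rV[R]_d) (w : Omega) : R :=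
  (\sum_(i < N) (xi w (X i) + xi w (Y i)) ^+ 2) / N%:R.

Lemma sigma_of_field_measurable (D : set 'rV[R]_d) A :
  sigma_of_field xi D A -> measurable A.
Proof.
apply: smallest_sub; first exact: sigma_algebra_measurable.
by move=> _ [x _ [B mB <-]]; exact: measurable_field.
Qed.

Lemma sigma_of_field_mean_square (D : set 'rV[R]_d) N X Y (B : set R) :
  (forall i, (i < N)%N -> D (X i)) -> (forall i, (i < N)%N -> D (Y i)) -> measurable B ->
  sigma_of_field xi D (mean_square N X Y @^-1` B).
Proof.
move=> DX DY mB.
pose S := \bigcup_(x in D) preimage_set_system setT (fun w => xi w x) (@measurable _ R).
have mxi x : D x -> measurable_fun setT (fun w : g_sigma_algebraType S => xi w x).
  move=> Dx _ E mE; apply: sub_sigma_algebra; exists x => //.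
  by exists E.
have : measurable_fun setT (mean_square N X Y : g_sigma_algebraType S -> R).
  apply: measurable_funM => //; apply: measurable_sum => i; apply: measurable_funX.
  by apply: measurable_funD; apply: mxi; [exact: DX|exact: DY].
by move=> /(_ measurableT _ mB); rewrite setTI.
Qed.

Lemma sigma_of_field_lim_sup (D : set 'rV[R]_d) (A : (set Omega)^nat) :
  (forall n, sigma_of_field xi D (A n)) -> sigma_of_field xi D (lim_sup_set A).
Proof.
pose S := \bigcup_(x in D) preimage_set_system setT (fun w => xi w x) (@measurable _ R).
move=> DA; have mA n : @measurable _ (g_sigma_algebraType S) (A n) by exact: DA.
have : @measurable _ (g_sigma_algebraType S) (lim_sup_set A).
  by apply: bigcap_measurable => // k _; apply: bigcup_measurable => j _; exact: mA.
by [].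
Qed.

End sigma_field.

(** * Chebyshev's inequality and the Borel-Cantelli argument *)

Section chebyshev.
Context d (T : measurableType d) (R : realType) (P : probability T R).

(** a^2 P(B) is at most the integral of f^2 over B, hence at most its integral over the whole
    space. *)
Lemma chebyshev_rintegrable (f : T -> R) (e a : R) (B : set T) : 0 < a ->
  measurable B -> (forall w, B w -> a <= `|f w|) -> rintegrable P (fun w => f w ^+ 2) ->
  \int[P]_w (f w ^+ 2) <= e * a ^+ 2 -> (P B <= e%:E)%E.
Proof.
move=> a0 mB Bf if2 fe.
have mf2 : measurable_fun setT (fun w => (f w ^+ 2)%:E) by exact: measurable_int if2.
have f20 w : setT w -> (0 <= (f w ^+ 2)%:E)%E by rewrite lee_fin sqr_ge0.
have a20 : 0 < a ^+ 2 by rewrite exprn_gt0.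
have : ((a ^+ 2)%:E * P B <= (e * a ^+ 2)%:E)%E.
  rewrite -integral_cst//; apply: (@le_trans _ _ (\int[P]_(w in B) (f w ^+ 2)%:E)%E).
    apply: ge0_le_integral => //.
    - by move=> w _; rewrite lee_fin ltW.
    - exact: measurable_funTS.
    - move=> w /Bf aw; rewrite lee_fin -[leRHS]real_normK ?num_real//.
      by rewrite ler_pXn2r ?nnegrE// ltW.
  apply: (@le_trans _ _ (\int[P]_w (f w ^+ 2)%:E)%E).
    exact: ge0_subset_integral.
  rewrite -[leLHS]fineK; last exact: integrable_fin_num.
  by rewrite lee_fin.
rewrite (_ : (e * a ^+ 2)%:E = ((a ^+ 2)%:E * e%:E)%E); last by rewrite -EFinM mulrC.
by rewrite lee_pmul2l ?lte_fin.
Qed.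

End chebyshev.

(** Take e = 2^-(m+1) for A_m. Summability makes the limit superior null under P1. Under P2 each
    tail union has full measure, its complement lying in that of every later A_m, and continuity
    from above passes this to the limit superior. *)
Lemma orthogonal_of_small d (T : measurableType d) (R : realType) (P1 P2 :
  probability T R)
    (S : set (set T)) :
  (forall A, S A -> measurable A) ->
  (forall A : (set T)^nat, (forall n, S (A n)) -> S (lim_sup_set A)) ->
  (forall e : R, 0 < e -> exists A, [/\ S A, (P1 A <= e%:E)%E & (P2 (~` A) <= e%:E)%E]) ->
  orthogonal_on P1 P2 S.
Proof.
move=> mS Slim small.
have e0 m : 0 < 1 / (2 ^ m.+1)%:R :> R by rewrite divr_gt0// ltr0n expn_gt0.
have /choice[A AP] : forall m : nat, exists A, [/\ S A,
    (P1 A <= (1 / (2 ^ m.+1)%:R)%:E)%E & (P2 (~` A) <= (1 / (2 ^ m.+1)%:R)%:E)%E].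
  by move=> m; exact: small.
have SA m : S (A m) by have [] := AP m.
have mA m : measurable (A m) by exact: mS.
exists (lim_sup_set A); split; first exact: Slim.
- apply: lim_sup_set_cvg0 => //.
  apply: (@le_lt_trans _ _ 1%:E); last exact: ltry.
  apply: le_trans (epsilon_trick0 xpredT (@ler01 R)).
  by apply: lee_nneseries => [i _ _|i _]; [exact: measure_ge0|by case: (AP i)].
- have U1 n : P2 (\bigcup_(k >= n) A k) = 1%E.
    have mU : measurable (\bigcup_(k >= n) A k) by exact: bigcup_measurable.
    have : P2 (~` \bigcup_(k >= n) A k) = 0%E.
      apply/eqP; rewrite eq_le measure_ge0 andbT; apply/lee_addgt0Pr => e ep.
      rewrite add0e.
      have [m [nm me]] : exists m, (n <= m)%N /\ 1 / (2 ^ m.+1)%:R <= e.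
        (* Then 2^(m+1) > m + 1 > 1/e, while the summand n ensures m >= n. *)
        exists (n + (Num.trunc e^-1).+1)%N; split; first exact: leq_addr.
        rewrite div1r -[leRHS]invrK lef_pV2 ?posrE ?invr_gt0// ?ltr0n ?expn_gt0//.
        apply/ltW/(lt_le_trans (truncnS_gt _)); rewrite ler_nat.
        apply: leq_trans (ltnW (ltn_expl _ (isT : (1 < 2)%N))).
        exact: leq_trans (leq_addl n _) (leqnSn _).
      apply: (@le_trans _ _ (P2 (~` A m))).
        apply: le_measure; rewrite ?inE; [exact: measurableC|exact: measurableC|].
        by apply: subsetC => w Aw; exists m.
      by apply: le_trans (_ : (1 / (2 ^ m.+1)%:R)%:E <= _)%E;
        [by case: (AP m)|rewrite lee_fin].
    move=> U0; rewrite -[X in P2 X]setCK probability_setC ?U0 ?sube0//.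
    exact: measurableC.
  have lim : P2 (\bigcup_(k >= n) A k) @[n --> \oo] --> P2 (lim_sup_set A).
    by apply: lim_sup_set_cvg => //; rewrite (le_lt_trans (probability_le1 _ _))
      ?ltry//; exact: bigcup_measurable.
  by apply: (cvg_unique _ lim) => //; apply: cvg_near_cst; apply: nearW => n; exact: U1.
Qed.

(** * Mean-square convergence at displaced lattice points *)

Section one_measure.
Context (R : realType) (n : nat) (disp : measure_display) (Omega : measurableType disp).
Variables (xi : {mfun Omega >-> field_space R n.+1}) (P : probability Omega R).
Variable F : {finite_measure set 'rV[R]_n.+1 -> \bar R}.
Hypothesis gauss : gaussian_field P xi.
Hypothesis mean0 : mean_zero P xi.
Let c := cov_fun P xi.
Hypothesis Fc : spectral_representation F c.
Hypothesis Fac : F `<< lebesgue_rV R n.+1.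
Hypothesis uc : unif_continuous (fun p : 'rV[R]_n.+1 * 'rV[R]_n.+1 => c p.1 p.2).
Variable h : 'rV[R]_n.+1.

Let latX (i : nat) : 'rV[R]_n.+1 := i%:R *: delta_mx ord0 ord0.
Let latY (i : nat) : 'rV[R]_n.+1 := i%:R *: delta_mx ord0 ord0 + h.
Let rho := lattice_cov c h 0 0.

Lemma cov_fun_unif (e : R) : 0 < e -> exists2 r : R, 0 < r &
  forall x y x' y', ball x r x' -> ball y r y' -> `|c x' y' - c x y| <= e.
Proof.
move=> e0; have /unif_continuousP/(_ e e0)[r r0 rP] := uc.
exists r => // x y x' y' xx' yy'; rewrite distrC.
by have := rP ((x, y), (x', y')) (conj xx' yy') => /ltW.
Qed.

Lemma lattice_cov_diag i : lattice_cov c h i i = rho.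
Proof. by rewrite /rho !(lattice_covE Fc) !subrr. Qed.

(** Uniform continuity supplies one radius r for all lattice points, independent of N. The
    displacement costs a multiple of eta^2 in the second moment; what remains is the mean of squared
    covariances, small for large N. *)
Lemma mean_square_L2 (e : R) : 0 < e -> exists2 r : R, 0 < r & exists N0 : nat,
  forall N, (N0 <= N)%N -> forall X Y : nat -> 'rV[R]_n.+1,
  (forall i, (i < N)%N -> ball (latX i) r (X i) /\ ball (latY i) r (Y i)) ->
  rintegrable P (fun w => (mean_square xi N X Y w - rho) ^+ 2) /\
  \int[P]_w ((mean_square xi N X Y w - rho) ^+ 2) <= e.
Proof.
(* The final bound is 80 eta^2 + 4 (e / 8). As eta <= 1, eta^2 <= eta <= e / 160, so each summand is
   at most e / 2. *)
move=> e0; pose eta := Num.min 1 (e / 160).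
have eta0 : 0 < eta by rewrite lt_min ltr01 divr_gt0.
have eta1 : eta <= 1 by rewrite ge_min lexx.
have eta2 : eta <= e / 160 by rewrite ge_min lexx orbT.
have [r r0 rP] := cov_fun_unif eta0; exists r => //.
have e8 : 0 < e / 8 by rewrite divr_gt0.
have /cvgrPdist_le /(_ _ e8)[N0 _ N0P] := cvg_lattice_cov_sqr_mean Fc Fac h.
exists (maxn N0 1) => N; rewrite geq_max => /andP[N0N N1] X Y XY.
pose U (i : 'I_N) w := xi w (X i) + xi w (Y i).
have GU i : lincombs xi (U i) by apply: lincombsD; exact: lincombs_field.
have [iT ->] := gaussian_quadratic_mean (lincombsD (xi := xi)) (lincombsB (xi := xi))
  (lincombs_integrable gauss mean0) (lincombs_moment4 gauss mean0) rho N1 GU.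
split=> //.
pose a (i j : 'I_N) := \int[P]_w (U i w * U j w).
rewrite -/a.
have aE i j : `|a i j - lattice_cov c h i j| <= 4 * eta.
  rewrite /a /U cov_pair// -/c /lattice_cov /pair_cov -/(latX i) -/(latX j) -/(latY
    i) -/(latY j).
  have [Xi Yi] := XY i (ltn_ord i); have [Xj Yj] := XY j (ltn_ord j).
  have := rP _ _ _ _ Xi Xj; have := rP _ _ _ _ Xi Yj.
  have := rP _ _ _ _ Yi Xj; have := rP _ _ _ _ Yi Yj.
  rewrite !ler_norml => /andP[? ?] /andP[? ?] /andP[? ?] /andP[? ?].
  by apply/andP; split; lra.
(* The product of variance errors is at most (4 eta)^2, and 2 u^2 <= 4 (u - L)^2 + 4 L^2 by (u - 2
   L)^2 >= 0, which gives 16 + 64 = 80. *)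
have term i j : (a i i - rho) * (a j j - rho) + 2 * a i j ^+ 2 <=
    80 * eta ^+ 2 + 4 * lattice_cov c h i j ^+ 2.
  have := aE i i; have := aE j j; have := aE i j; rewrite !lattice_cov_diag.
  set p := a i i - rho; set q := a j j - rho.
  set L := lattice_cov c h i j; set u := a i j.
  move=> /ler_normlP[u1 u2] /ler_normlP[q1 q2] /ler_normlP[p1 p2].
  have : p * q <= 16 * eta ^+ 2 by nra.
  have : (u - L) ^+ 2 <= 16 * eta ^+ 2 by nra.
  have : 0 <= (u - 2 * L) ^+ 2 by exact: sqr_ge0.
  by nra.
have N20 : 0 < N%:R ^+ 2 :> R by rewrite exprn_gt0// ltr0n.
apply: (@le_trans _ _ (80 * eta ^+ 2 + 4 * ((\sum_(i < N) \sum_(j < N) lattice_cov c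
  h i j ^+ 2) / N%:R ^+ 2))).
  rewrite ler_pdivrMr// mulrDl -[4 * _ * _]mulrA divfK ?gt_eqF// mulr_sumr.
  have -> : 80 * eta ^+ 2 * N%:R ^+ 2 = \sum_(i < N) \sum_(j < N) 80 * eta ^+ 2.
    have hh (x : R) : \sum_(i < N) x = x * N%:R by rewrite sumr_const card_ord mulr_natr.
    by rewrite (eq_bigr (fun=> 80 * eta ^+ 2 * N%:R)) => [|i _];
      rewrite hh// [N%:R ^+ 2]expr2 mulrA.
  rewrite -big_split; apply: ler_sum => i _ /=.
  by rewrite mulr_sumr -big_split; apply: ler_sum => j _; exact: term.
have := N0P N N0N; rewrite sub0r normrN => /(le_trans (ler_norm _)) h1.
have : eta ^+ 2 <= e / 160 by nra.
by lra.
Qed.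

End one_measure.

Lemma dense_ball (R : realType) n (D : set 'rV[R]_n) (z : 'rV[R]_n) (r : R) :
  dense D -> 0 < r -> exists2 x, D x & ball z r x.
Proof.
move=> denseD r0; have [|x [zx Dx]] := denseD (interior (ball z r)) _ (open_interior _).
  by exists z; exact: nbhsx_ballx.
by exists x => //; exact: interior_subset zx.
Qed.

(** These variances determine k: h = 0 gives k 0, and then any h gives k h. *)
Lemma lattice_cov00 (R : realType) n (c : 'rV[R]_n.+1 -> 'rV[R]_n.+1 -> R) (k :
  'rV[R]_n.+1 -> R) h :
  (forall x y, c x y = c y x) -> (forall x y, c x y = k (x - y)) ->
  lattice_cov c h 0 0 = 2 * k 0 + 2 * k h.
Proof.
move=> cC ck; rewrite /lattice_cov /pair_cov scale0r add0r (cC 0 h) !ck !subrr subr0.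
ring.
Qed.

Unset Implicit Arguments.

Theorem theorem2p5 (R : realType) (d : nat) (d_ge1 : (1 <= d)%N)
  (disp : measure_display) (Omega : measurableType disp)
  (xi : {mfun Omega >-> field_space R d})
  (P1 P2 : probability Omega R)
  (gauss1 : gaussian_field P1 xi) (gauss2 : gaussian_field P2 xi)
  (mean1 : mean_zero P1 xi) (mean2 : mean_zero P2 xi)
  (stat1 : stationary P1 xi) (stat2 : stationary P2 xi)
  (k1 k2 : 'rV[R]_d -> R)
  (cov1 : forall x y : 'rV[R]_d, cov_fun P1 xi x y = k1 (x - y))
  (cov2 : forall x y : 'rV[R]_d, cov_fun P2 xi x y = k2 (x - y))
  (F1 F2 : {finite_measure set 'rV[R]_d -> \bar R})
  (spec1 : spectral_measure F1 (cov_fun P1 xi))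
  (spec2 : spectral_measure F2 (cov_fun P2 xi))
  (ac1 : F1 `<< lebesgue_rV R d) (ac2 : F2 `<< lebesgue_rV R d)
  (f1 f2 : 'rV[R]_d -> R)
  (dens1 : spectral_density F1 f1) (dens2 : spectral_density F2 f2)
  (bnd1 : [bounded f1 l | l in [set: 'rV[R]_d]])
  (bnd2 : [bounded f2 l | l in [set: 'rV[R]_d]])
  (neq : (0 < lebesgue_rV R d [set l | f1 l <> f2 l])%E)
  (uc1 : unif_continuous
     (fun p : 'rV[R]_d * 'rV[R]_d => cov_fun P1 xi p.1 p.2))
  (uc2 : unif_continuous
     (fun p : 'rV[R]_d * 'rV[R]_d => cov_fun P2 xi p.1 p.2))
  (D : set 'rV[R]_d) (denseD : dense D) :
  orthogonal_on P1 P2 (sigma_of_field xi D).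

Proof.
(* Writing the dimension as n.+1 makes the first basis vector available. *)
case: d d_ge1 xi gauss1 gauss2 mean1 mean2 stat1 stat2 k1 k2 cov1 cov2 F1 F2 spec1 spec2
  ac1 ac2 f1 f2 dens1 dens2 bnd1 bnd2 neq uc1 uc2 D denseD => // n _ xi gauss1 gauss2
  mean1 mean2 _ _ k1 k2 cov1 cov2 F1 F2 spec1 spec2 ac1 ac2 f1 f2 dens1 dens2 _ _ neq
  uc1 uc2 D denseD.
have covC P x y : cov_fun P xi x y = cov_fun P xi y x.
  by rewrite !cov_funE; apply: eq_Rintegral => w _; rewrite mulrC.
pose rho1 h := lattice_cov (cov_fun P1 xi) h 0 0.
pose rho2 h := lattice_cov (cov_fun P2 xi) h 0 0.
have [h rho12] : exists h, rho1 h != rho2 h.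
  (* If all variances agreed, so would k1 and k2, hence the covariances, against
     [spectral_density_neq]. *)
  apply: contrapT => /forallNP rhoE.
  have kE h : 2 * k1 0 + 2 * k1 h = 2 * k2 0 + 2 * k2 h.
    rewrite -(lattice_cov00 _ (covC P1) cov1) -(lattice_cov00 _ (covC P2) cov2).
    by apply/eqP; apply: contrapT => /negP; exact: rhoE.
  apply: (spectral_density_neq spec1 spec2 dens1 dens2 neq).
  apply/funext => x; apply/funext => y; rewrite cov1 cov2.
  have := kE 0; have := kE (x - y); lra.
(* Half the gap: a value within a of [rho2 h] is at distance at least a from [rho1 h]. A mean-square
   error e a^2 then becomes probability e by Chebyshev. *)
pose a := `|rho1 h - rho2 h| / 2.
have a0 : 0 < a by rewrite divr_gt0// normr_gt0 subr_eq0.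
apply: orthogonal_of_small.
- exact: sigma_of_field_measurable.
- exact: sigma_of_field_lim_sup.
move=> e e0; have ea0 : 0 < e * a ^+ 2 by rewrite mulr_gt0// exprn_gt0.
have [r1 r10 [N1 H1]] := mean_square_L2 gauss1 mean1 spec1.1 ac1 uc1 h ea0.
have [r2 r20 [N2 H2]] := mean_square_L2 gauss2 mean2 spec2.1 ac2 uc2 h ea0.
(* The same N and the same points of D must serve under both measures. *)
pose N := maxn N1 N2; pose r := Num.min r1 r2.
have r0 : 0 < r by rewrite lt_min r10.
have /choice[X XP] : forall i : nat, exists x, D x /\ ball (i%:R *: delta_mx ord0
  ord0 : 'rV[R]_n.+1) r x.
  by move=> i; have [x Dx zx] := dense_ball (i%:R *: delta_mx ord0 ord0) denseD r0;
    exists x.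
have /choice[Y YP] : forall i : nat, exists x, D x /\ ball (i%:R *: delta_mx ord0
  ord0 + h) r x.
  by move=> i; have [x Dx zx] := dense_ball (i%:R *: delta_mx ord0 ord0 + h) denseD
    r0; exists x.
have [i1 le1] : rintegrable P1 (fun w => (mean_square xi N X Y w - rho1 h) ^+ 2) /\
    \int[P1]_w ((mean_square xi N X Y w - rho1 h) ^+ 2) <= e * a ^+ 2.
  apply: H1 => [|i _]; first exact: leq_maxl.
  by split; (apply: le_ball (_ : r <= r1) _ _; first by rewrite ge_min lexx);
    [exact: (XP i).2|exact: (YP i).2].
have [i2 le2] : rintegrable P2 (fun w => (mean_square xi N X Y w - rho2 h) ^+ 2) /\
    \int[P2]_w ((mean_square xi N X Y w - rho2 h) ^+ 2) <= e * a ^+ 2.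
  apply: H2 => [|i _]; first exact: leq_maxr.
  by split; (apply: le_ball (_ : r <= r2) _ _; first by rewrite ge_min lexx orbT);
    [exact: (XP i).2|exact: (YP i).2].
pose B : set R := `]rho2 h - a, rho2 h + a[%classic.
exists (mean_square xi N X Y @^-1` B).
have SA : sigma_of_field xi D (mean_square xi N X Y @^-1` B).
  apply: sigma_of_field_mean_square; [by move=> i _; exact: (XP i).1|by move=> i _;
    exact: (YP i).1|].
  exact: measurable_itv.
have mA := sigma_of_field_measurable SA.
split => //.
- apply: (chebyshev_rintegrable a0 mA _ i1 le1) => w.
  rewrite /B /= in_itv/= -ltr_distl => wB.
  (* The gap is 2 a and the second distance is below a on the event, so the first is at least a. *)
  have tri : `|rho1 h - rho2 h| <= `|mean_square xi N X Y w - rho1 h| +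
    `|mean_square xi N X Y w - rho2 h|.
    by rewrite (distrC _ (rho1 h)) ler_distD.
  have aE : `|rho1 h - rho2 h| = 2 * a by rewrite mulrC divfK.
  lra.
- apply: (chebyshev_rintegrable a0 (measurableC mA) _ i2 le2) => w.
  by rewrite /B /= in_itv/= -ltr_distl => /negP; rewrite -leNgt.
Qed.
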